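(* There is a real constant $L$, only depending on the bound of $f$ and the Lipschitz constants of $f(s,\cdot,u,v)$ and of $g$ (the horizon $T$ being fixed), such that, for every partition $\Pi$ of the interval $[0,T]$ and all $(t,x),(t',x')\in[0,T]\times\mathbb R^d$, $$|V^\Pi(t,x)-V^\Pi(t',x')|+|U^\Pi(t,x)-U^\Pi(t',x')|\le L\,(|t-t'|+|x-x'|).$$
   Context: Setting. $T>0$ is fixed, $U,V$ are compact metric spaces, $f:[0,T]\times\mathbb R^d\times U\times V\to\mathbb R^d$ is bounded, continuous, and Lipschitz in $x$ uniformly with respect to $(t,u,v)$, and $g:\mathbb R^d\to\mathbb R$ is bounded and Lipschitz. Probability space. $(\Omega,\mathcal F,P)=\big(([0,1]^2)^{\mathbb N},\mathcal B([0,1]^2)^{\otimes\mathbb N},\lambda_2^{\otimes\mathbb N}\big)$, with $\mathbb N$ the positive integers and $\lambda_2$ two-dimensional Lebesgue (Borel) measure on $[0,1]^2$. The coordinate maps are $\zeta_j=(\zeta_{j,1},\zeta_{j,2}):\Omega\to[0,1]^2$, $j\ge1$. Put $\mathcal G_j=\sigma(\zeta_{j,1})$, $\mathcal H_j=\sigma(\zeta_{j,2})$, $\mathcal F_j=\sigma(\zeta_1,\dots,\zeta_j)$ for $j\ge1$, and $\mathcal F_0$ the trivial $\sigma$-field. $\mathbb F=(\mathcal F_j)$; a random time $\tau:\Omega\to\{0,1,2,\dots\}$ is an $\mathbb F$-stopping time if $\{\tau=j\}\in\mathcal F_j$ for all $j\ge0$. Admissible controls. Let $\Pi=\{0=t_0<\dots<t_n=T\}$.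 For a sub-$\sigma$-field $\mathcal K\subset\mathcal F$, $L^0_{\mathcal K}(a,b;E)$ denotes the (jointly) measurable $E$-valued processes $(u_s)$ on the time interval from $a$ to $b$ with $u_s$ $\mathcal K$-measurable for every $s$. $\mathcal U^\Pi_{0,T}$ is the set of $u\in L^0_{\mathcal F}(0,T;U)$ such that for each $1\le j\le n$, $u|_{[t_{j-1},t_j)}=\sum_{k\ge1}I_{\Gamma_{j,k}}u^{j,k}$ (i.e. $u=u^{j,k}$ on $\Gamma_{j,k}$), where $(\Gamma_{j,k})_{k\ge1}\subset\mathcal F_{j-1}$ is a partition of $\Omega$ and $u^{j,k}\in L^0_{\mathcal G_j}(t_{j-1},t_j;U)$. $\mathcal V^\Pi_{0,T}$ is defined in the same way with $V$ and $\mathcal H_j$ in place of $U$ and $\mathcal G_j$. For $0\le t\le t_l\in\Pi$, $\mathcal U^\Pi_{t,t_l}$ and $\mathcal V^\Pi_{t,t_l}$ are the sets of restrictions of these controls to $[t,t_l]$. Dynamics. For $(u,v)\in\mathcal U^\Pi_{t,T}\times\mathcal V^\Pi_{t,T}$, $X^{t,x,u,v}$ is the unique pathwise solution of $X_s=x+\int_t^sf(r,X_r,u_r,v_r)\,dr$, $s\in[t,T]$. NAD-strategies. $\mathcal B^\Pi_{t,t_l}$ is the set of maps $\beta:\mathcal U^\Pi_{t,t_l}\to\mathcal V^\Pi_{t,t_l}$ such that for every $\mathbb F$-stopping time $\tau:\Omega\to\{0,\dots,n-1\}$ and all $u,u'\in\mathcal U^\Pi_{t,t_l}$ with $u=u'$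 $dsdP$-a.s. on $\{(s,\omega):t\le s\le t_{\tau(\omega)}\}$, one has $\beta(u)=\beta(u')$ $dsdP$-a.s. on $\{(s,\omega):t\le s\le t_{\tau(\omega)+1}\}$ (times restricted to $[t,t_l]$). $\mathcal A^\Pi_{t,t_l}$ is the symmetric set of maps $\alpha:\mathcal V^\Pi_{t,t_l}\to\mathcal U^\Pi_{t,t_l}$. For every $(\alpha,\beta)\in\mathcal A^\Pi_{t,t_l}\times\mathcal B^\Pi_{t,t_l}$ there is a $dsdP$-a.s. unique $(u,v)\in\mathcal U^\Pi_{t,t_l}\times\mathcal V^\Pi_{t,t_l}$ with $\alpha(v)=u$, $\beta(u)=v$; one sets $X^{t,x,\alpha,\beta}:=X^{t,x,u,v}$. Value functions along $\Pi$. For $t_i\le t<t_{i+1}$ ($0\le i\le n-1$), $$V^\Pi(t,x)=\operatorname{esssup}_{\alpha\in\mathcal A^\Pi_{t,T}}\operatorname{essinf}_{\beta\in\mathcal B^\Pi_{t,T}}E[g(X_T^{t,x,\alpha,\beta})|\mathcal F_i],\quad U^\Pi(t,x)=\operatorname{essinf}_{\beta\in\mathcal B^\Pi_{t,T}}\operatorname{esssup}_{\alpha\in\mathcal A^\Pi_{t,T}}E[g(X_T^{t,x,\alpha,\beta})|\mathcal F_i],$$ and $V^\Pi(T,x)=U^\Pi(T,x)=g(x)$. These random variables are $P$-a.s. constant and are identified with the deterministic functions $V^\Pi(t,x):=E[V^\Pi(t,x)]$, $U^\Pi(t,x):=E[U^\Pi(t,x)]$. *)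

(* Defs.v *)
From HB Require Import structures.
From mathcomp Require Import all_boot all_order all_algebra.
From mathcomp Require Import all_classical all_reals all_analysis.

Set Implicit Arguments.
Unset Strict Implicit.
Unset Printing Implicit Defensive.

Import Order.TTheory GRing.Theory Num.Theory.
Import numFieldNormedType.Exports.

Local Open Scope classical_set_scope.
Local Open Scope ring_scope.

(* The library norm on row vectors is the sup norm; R^d carries the Euclidean
   one (the constant of the theorem must not depend on the dimension). *)
Definition enorm (R : realType) (d : nat) (x : 'rV[R]_d) : R :=
  Num.sqrt (\sum_(i < d) x 0 i ^+ 2).

Section SampleSpace.
Context (R : realType).

Definition in_unit_square (z : R * R) : bool :=
  (0 <= z.1 <= 1) && (0 <= z.2 <= 1).

Definition square : Type := {z : R * R | in_unit_square z}.

Lemma in_unit_square0 : in_unit_square (0, 0).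
Proof. by rewrite /in_unit_square /= lexx ler01. Qed.

HB.instance Definition _ := Choice.on square.
HB.instance Definition _ :=
  isPointed.Build square (exist _ (0, 0) in_unit_square0).

Definition Omega : Type := nat -> square.

HB.instance Definition _ := Pointed.on Omega.

(* The coordinates zeta_1, zeta_2, ... are numbered from 1 and stored from 0:
   zeta j is meaningful for j >= 1 only. *)
Definition zeta (j : nat) (w : Omega) : R * R := sval (w j.-1).

Definition coord_events (J : set nat) : set (set Omega) :=
  \bigcup_(j in J) preimage_set_system setT (zeta j) measurable.

Definition Omega_events : set (set Omega) :=
  coord_events [set j | (0 < j)%N].

HB.instance Definition _ :=
  Measurable.copy Omega (g_sigma_algebraType Omega_events).

Definition sigF (j : nat) : set (set Omega) :=
  <<s coord_events [set k | (0 < k <= j)%N] >>.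

Definition sigG (j : nat) : set (set Omega) :=
  g_sigma_algebra_preimage (fun w : Omega => (zeta j w).1).

Definition sigH (j : nat) : set (set Omega) :=
  g_sigma_algebra_preimage (fun w : Omega => (zeta j w).2).

(* P is the countable power of the Lebesgue measure of the unit square; the
   values on finite-dimensional cylinders determine P. *)
Definition is_lebesgue_power (P : probability Omega R) : Prop :=
  forall (m : nat) (A : nat -> set (R * R)), (forall j, measurable (A j)) ->
    P [set w | forall j, (0 < j <= m)%N -> A j (zeta j w)] =
    \big[mule/1%E]_(1 <= j < m.+1)
       (lebesgue_measure \x lebesgue_measure)%E
         (A j `&` [set z | in_unit_square z]).

Definition stopping_time (tau : Omega -> nat) : Prop :=
  forall j, sigF j [set w | tau w = j].

Section CondExpEsssup.
Context (P : probability Omega R).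

Definition is_condexp (K : set (set Omega)) (Y Z : Omega -> R) : Prop :=
  [/\ forall B : set R, measurable B -> K (Z @^-1` B),
      P.-integrable setT (EFin \o Z) &
      forall A, K A -> (\int[P]_(w in A) (Z w)%:E = \int[P]_(w in A) (Y w)%:E)%E].

Definition condexp (K : set (set Omega)) (Y : Omega -> R) : Omega -> R :=
  xget (cst 0) [set Z | is_condexp K Y Z].

(* Essential bounds of families of random variables (not of one function).
   Real values are enough: they are only taken over nonempty uniformly bounded
   families. *)
Definition is_esssup (I : Type) (S : set I) (Y : I -> Omega -> R)
    (Z : Omega -> R) : Prop :=
  [/\ measurable_fun setT Z,
      forall i, S i -> \forall w \ae P, Y i w <= Z w &
      forall Z' : Omega -> R, measurable_fun setT Z' ->
        (forall i, S i -> \forall w \ae P, Y i w <= Z' w) ->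
        \forall w \ae P, Z w <= Z' w].

Definition is_essinf (I : Type) (S : set I) (Y : I -> Omega -> R)
    (Z : Omega -> R) : Prop :=
  [/\ measurable_fun setT Z,
      forall i, S i -> \forall w \ae P, Z w <= Y i w &
      forall Z' : Omega -> R, measurable_fun setT Z' ->
        (forall i, S i -> \forall w \ae P, Z' w <= Y i w) ->
        \forall w \ae P, Z' w <= Z w].

Definition esssup_fam (I : Type) (S : set I) (Y : I -> Omega -> R) :
    Omega -> R :=
  xget (cst 0) [set Z | is_esssup S Y Z].

Definition essinf_fam (I : Type) (S : set I) (Y : I -> Omega -> R) :
    Omega -> R :=
  xget (cst 0) [set Z | is_essinf S Y Z].

End CondExpEsssup.

End SampleSpace.

(* A process on a time interval is a total function of which only the values
   on that interval matter. *)
Definition process (R : realType) (E : Type) : Type := R -> Omega R -> E.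

Definition borel (E : topologicalType) : set (set E) :=
  <<s [set B : set E | open B] >>.

(* Joint measurability is with respect to the full sigma-field on Omega;
   only the marginals are K-measurable. *)
Definition L0 (R : realType) (E : topologicalType) (K : set (set (Omega R)))
    (a b : R) (u : process R E) : Prop :=
  (forall B, borel B ->
    measurable [set z : R * Omega R | a <= z.1 <= b /\ B (u z.1 z.2)]) /\
  (forall s, a <= s <= b -> forall B, borel B -> K (u s @^-1` B)).

Section Game.
Context (R : realType) (T : R).

(* A partition 0 = t_0 < t_1 < ... < t_n = T is the list pi = [t_1; ...; t_n]
   with itv_partition 0 T pi; here n = size pi and t_j = tpt pi j for j <= n. *)
Definition tpt (pi : seq R) (j : nat) : R := nth 0 (0 :: pi) j.

(* Controls on [0, T]; K is the family of sigma-fields sigG or sigH. *)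
Definition admissible (E : topologicalType) (K : nat -> set (set (Omega R)))
    (pi : seq R) (u : process R E) : Prop :=
  L0 measurable 0 T u /\
  forall j, (1 <= j <= size pi)%N ->
    exists (Gam : nat -> set (Omega R)) (w : nat -> process R E),
      [/\ forall k, sigF j.-1 (Gam k),
          trivIset setT Gam,
          \bigcup_k Gam k = setT,
          forall k, L0 (K j) (tpt pi j.-1) (tpt pi j) (w k) &
          forall k s om, tpt pi j.-1 <= s < tpt pi j -> Gam k om ->
            u s om = w k s om].

Definition eq_on (E : Type) (t : R) (u u' : process R E) : Prop :=
  forall s om, t <= s <= T -> u s om = u' s om.

(* Restrictions of controls to [t, T]. *)
Definition controls (E : topologicalType) (K : nat -> set (set (Omega R)))
    (pi : seq R) (t : R) : set (process R E) :=
  [set u | exists2 w, admissible K pi w & eq_on t u w].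

Context (P : probability (Omega R) R).

Definition ae_eq_upto (E : Type) (t : R) (theta : Omega R -> R)
    (u u' : process R E) : Prop :=
  \forall z \ae (lebesgue_measure \x P)%E,
    t <= z.1 <= theta z.2 -> u z.1 z.2 = u' z.1 z.2.

(* Maps between two sets of controls on [t, T]; the second clause says that the
   image only depends on the restriction of the argument to [t, T]. *)
Definition NAD (E E' : topologicalType) (K K' : nat -> set (set (Omega R)))
    (pi : seq R) (t : R) : set (process R E -> process R E') :=
  [set beta | [/\
    forall u, controls K pi t u -> controls K' pi t (beta u),
    forall u u', controls K pi t u -> controls K pi t u' ->
      eq_on t u u' -> eq_on t (beta u) (beta u') &
    forall tau : Omega R -> nat, stopping_time tau ->
      (forall om, (tau om < size pi)%N) ->
      forall u u', controls K pi t u -> controls K pi t u' ->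
        ae_eq_upto t (fun om => tpt pi (tau om)) u u' ->
        ae_eq_upto t (fun om => tpt pi (tau om).+1) (beta u) (beta u')]].

Context (d : nat) (U V : metricType R).
Context (f : R -> 'rV[R]_d -> U -> V -> 'rV[R]_d) (g : 'rV[R]_d -> R).

Definition stratA (pi : seq R) (t : R) : set (process R V -> process R U) :=
  NAD (@sigH R) (@sigG R) pi t.

Definition stratB (pi : seq R) (t : R) : set (process R U -> process R V) :=
  NAD (@sigG R) (@sigH R) pi t.

Definition is_trajectory (t : R) (x : 'rV[R]_d) (u : R -> U) (v : R -> V)
    (X : R -> 'rV[R]_d) : Prop :=
  {within `[t, T], continuous X} /\
  forall s, t <= s <= T ->
    X s = x + \row_(k < d)
      \int[lebesgue_measure]_(r in `[t, s]) (f r (X r) (u r) (v r) 0 k).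

Definition traj (t : R) (x : 'rV[R]_d) (u : process R U) (v : process R V)
    (om : Omega R) : R -> 'rV[R]_d :=
  xget (cst 0)
    [set X | is_trajectory t x (fun s => u s om) (fun s => v s om) X].

Definition is_couple (pi : seq R) (t : R)
    (alpha : process R V -> process R U) (beta : process R U -> process R V)
    (u : process R U) (v : process R V) : Prop :=
  [/\ controls (@sigG R) pi t u, controls (@sigH R) pi t v,
      ae_eq_upto t (cst T) (alpha v) u & ae_eq_upto t (cst T) (beta u) v].

Definition traj_strat (pi : seq R) (t : R) (x : 'rV[R]_d)
    (alpha : process R V -> process R U) (beta : process R U -> process R V) :
    Omega R -> R -> 'rV[R]_d :=
  xget (cst (cst 0))
    [set X | exists u v, is_couple pi t alpha beta u v /\ X = traj t x u v].

(* The index i such that t_i <= t < t_(i+1), for 0 <= t < T. *)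
Definition time_index (pi : seq R) (t : R) : nat := find (fun r => t < r) pi.

Definition cond_payoff (pi : seq R) (t : R) (x : 'rV[R]_d)
    (alpha : process R V -> process R U) (beta : process R U -> process R V) :
    Omega R -> R :=
  condexp P (@sigF R (time_index pi t))
    (fun om => g (traj_strat pi t x alpha beta om T)).

(* The deterministic value functions: expectations of the random ones. *)
Definition lower_value (pi : seq R) (t : R) (x : 'rV[R]_d) : R :=
  if t == T then g x else
  fine ('E_P[esssup_fam P (stratA pi t) (fun alpha =>
               essinf_fam P (stratB pi t) (fun beta =>
                 cond_payoff pi t x alpha beta))])%E.

Definition upper_value (pi : seq R) (t : R) (x : 'rV[R]_d) : R :=
  if t == T then g x else
  fine ('E_P[essinf_fam P (stratB pi t) (fun beta =>
               esssup_fam P (stratA pi t) (fun alpha =>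
                 cond_payoff pi t x alpha beta))])%E.

End Game.

(* Main.v *)
Require Import Defs.
From HB Require Import structures.
From mathcomp Require Import all_boot all_order all_algebra.
From mathcomp Require Import all_classical all_reals all_analysis.
From mathcomp Require Import measurable_realfun finmap ring lra.

Set Implicit Arguments.
Unset Strict Implicit.
Unset Printing Implicit Defensive.

Import Order.TTheory GRing.Theory Num.Theory.
Import numFieldNormedType.Exports.

Local Open Scope classical_set_scope.
Local Open Scope ring_scope.

(** Fix a partition and a starting time t < T lying in [t_i, t_(i+1)[.

    The values as deterministic bounds. The random values are essential suprema
    and infima of the payoffs J(alpha, beta) = E[g(X_T) | F_i]. Two strategies can
    be pasted along an event of F_i into a strategy again, and pasting strategies
    pastes the couples of controls: a couple is unique almost everywhere on any
    event of F_i on which its strategies are given ([couples_agree]), and it exists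
    by alternate iteration of the strategies ([couple_exists]). Hence for fixed
    alpha the family J(alpha, .) is directed downwards, and the family of its
    essential infima is directed upwards. A directed bounded family attains its
    essential bound along a monotone sequence, so the bound commutes with the
    expectation ([essinf_directed], [nested_essential_bounds]). Consequently
    ([lower_valueE], [upper_valueE])

      E[V(t,x)] = sup_alpha inf_beta E[g(X_T)],
      E[U(t,x)] = inf_beta sup_alpha E[g(X_T)],

    and it remains to compare expected payoffs of two games.

    Matching the games. For t <= t', a strategy of the game started at t' extends
    to t by playing a constant control on [t, t'[ ([NAD_extend]); a strategy of the
    game started at t acts on controls started at t' once these are extended by a
    constant ([NAD_restrict]). If one player extends and the other restricts, the
    same controls (u, v) form a couple in both games: beyond t' this is clear, and
    before t' the extended player does play the constant that the restricted
    player is told ([switch_restart], [expected_extendA], [expected_extendB]). So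
    both payoffs are those of one pair of controls, from two starting points. For
    t' = T the second game is the constant payoff g(x').

    Trajectories. Measured with the weight exp(2K(s - t)), the Picard map contracts
    with ratio 1/2, which gives existence of the trajectories, their uniqueness and
    the stability estimate

      |X_T - X'_T| <= 2 (|x - x'| + Cf |t - t'|) exp(2KT)

    with K = |Lf| + 1 ([solves_stable], [solves_compare]); the Euclidean norm of an
    integral is at most the integral of the norm, so the constant does not involve
    the dimension. Multiplication by the Lipschitz constant of g yields
    [value_lipschitz]. The trajectory at time T is a random variable because the
    Picard iterates are jointly measurable ([exists_measurable_solution]); the field
    along a measurable process is measurable since a continuous function on a
    separable space sends measurable processes to measurable ones
    ([measurable_comp_within]). *)

(** * The Euclidean norm and integrals of vector functions *)

Section EuclideanNorm.
Context (R : realType) (d : nat).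
Implicit Types x y : 'rV[R]_d.

Lemma enorm_ge0 x : 0 <= enorm x. Proof. exact: sqrtr_ge0. Qed.

Lemma enorm_sqr x : enorm x ^+ 2 = \sum_(i < d) x 0 i ^+ 2.
Proof. by rewrite sqr_sqrtr// sumr_ge0// => i _; exact: sqr_ge0. Qed.

Lemma enorm0 : enorm (0 : 'rV[R]_d) = 0.
Proof. by rewrite /enorm big1 ?sqrtr0// => i _; rewrite mxE expr0n. Qed.

Lemma enormN x : enorm (- x) = enorm x.
Proof. by congr Num.sqrt; apply: eq_bigr => i _; rewrite mxE sqrrN. Qed.

Lemma enormB x y : enorm (x - y) = enorm (y - x).
Proof. by rewrite -enormN opprB. Qed.

Lemma ler_enorm x (i : 'I_d) : `|x 0 i| <= enorm x.
Proof.
rewrite -ler_sqr ?nnegrE ?enorm_ge0// enorm_sqr real_normK ?num_real//.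
by rewrite (bigD1 i)//= lerDl sumr_ge0// => j _; exact: sqr_ge0.
Qed.

Lemma enorm_eq0 x : enorm x = 0 -> x = 0.
Proof.
move=> x0; apply/rowP => i; rewrite mxE; apply/eqP.
by rewrite -normr_le0 -x0 ler_enorm.
Qed.

(** Expand the sum of the squares of the coordinates of |y| x - |x| y. *)
Lemma enorm_cauchy_schwarz x y : \sum_(i < d) x 0 i * y 0 i <= enorm x * enorm y.
Proof.
have [/enorm_eq0->|x0] := eqVneq (enorm x) 0.
  by rewrite enorm0 mul0r big1// => i _; rewrite mxE mul0r.
have [/enorm_eq0->|y0] := eqVneq (enorm y) 0.
  by rewrite enorm0 mulr0 big1// => i _; rewrite mxE mulr0.
set a := enorm x; set b := enorm y; set s := \sum_(i < d) _.
have a0 : 0 < a by rewrite lt_def x0 enorm_ge0.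
have b0 : 0 < b by rewrite lt_def y0 enorm_ge0.
have : 0 <= \sum_(i < d) (b * x 0 i - a * y 0 i) ^+ 2.
  by rewrite sumr_ge0// => i _; exact: sqr_ge0.
have -> : \sum_(i < d) (b * x 0 i - a * y 0 i) ^+ 2 =
    b ^+ 2 * a ^+ 2 + a ^+ 2 * b ^+ 2 - (2 * (a * b)) * s.
  rewrite [in X in b ^+ 2 * X]enorm_sqr [in X in a ^+ 2 * X]enorm_sqr.
  rewrite !mulr_sumr -big_split/= -sumrB.
  by apply: eq_bigr => i _; ring.
rewrite (_ : _ - _ = (2 * (a * b)) * (a * b - s)); last by ring.
by rewrite pmulr_rge0 ?subr_ge0// !mulr_gt0.
Qed.

Lemma ler_enormD x y : enorm (x + y) <= enorm x + enorm y.
Proof.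
rewrite -ler_sqr ?nnegrE ?addr_ge0 ?enorm_ge0// sqrrD !enorm_sqr.
rewrite (_ : \sum_(i < d) (x + y) 0 i ^+ 2 =
    \sum_(i < d) x 0 i ^+ 2 + (\sum_(i < d) x 0 i * y 0 i) *+ 2 +
    \sum_(i < d) y 0 i ^+ 2); last first.
  rewrite -sumrMnl -!big_split/=.
  by apply: eq_bigr => i _; rewrite !mxE sqrrD.
by rewrite lerD2r lerD2l lerMn2r enorm_cauchy_schwarz orbT.
Qed.

Lemma ler_enorm_distD x y z : enorm (x - z) <= enorm (x - y) + enorm (y - z).
Proof. by rewrite -[x - z](subrKA y) ler_enormD. Qed.

Lemma ler_enorm_sum x : enorm x <= \sum_(i < d) `|x 0 i|.
Proof.
have s0 : 0 <= \sum_(i < d) `|x 0 i| by rewrite sumr_ge0.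
rewrite -ler_sqr ?nnegrE ?enorm_ge0// enorm_sqr expr2 mulr_suml.
apply: ler_sum => i _; rewrite -real_normK ?num_real// expr2 ler_wpM2l//.
by rewrite (bigD1 i)//= lerDl sumr_ge0.
Qed.

End EuclideanNorm.

Section VectorIntegral.
Context (R : realType) d (S : measurableType d) (mu : {measure set S -> \bar R}).

Lemma bounded_integrable (D : set S) (h : S -> R) (M : R) :
  measurable D -> (mu D < +oo)%E -> measurable_fun D h ->
  (forall x, D x -> `|h x| <= M) -> mu.-integrable D (EFin \o h).
Proof.
move=> mD fD mh hM; apply: measurable_bounded_integrable => //.
exists M; split; first exact: num_real.
by move=> N MN x Dx /=; rewrite (le_trans (hM x Dx))// ltW.
Qed.

Lemma Rintegral_sum (D : set S) (n : nat) (h : 'I_n -> S -> R) :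
  measurable D -> (forall i, mu.-integrable D (EFin \o h i)) ->
  \int[mu]_(x in D) (\sum_(i < n) h i x) = \sum_(i < n) \int[mu]_(x in D) h i x.
Proof.
move=> mD; elim: n h => [|n IH] h ih.
  under eq_Rintegral do rewrite big_ord0.
  by rewrite big_ord0 Rintegral_cst// mul0r.
under eq_Rintegral do rewrite big_ord_recl.
rewrite RintegralD//; first by rewrite big_ord_recl IH.
rewrite [X in integrable _ _ X](_ : _ =
  (fun x => \sum_(i < n) (h (lift ord0 i) x)%:E)%E); last first.
  by apply/funext => x /=; rewrite sumEFin.
by apply: integrable_sum => // i _; exact: ih.
Qed.

Definition vintegral n (D : set S) (h : S -> 'rV[R]_n) : 'rV[R]_n :=
  \row_(k < n) \int[mu]_(x in D) (h x 0 k).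

(** Pairing the integral with itself turns the vector inequality into a scalar
    one, whence a bound free of dimensional constants. *)
Lemma enorm_vintegral_le n (D : set S) (h : S -> 'rV[R]_n) (m : S -> R) :
  measurable D -> (forall k, mu.-integrable D (fun x => (h x 0 k)%:E)) ->
  mu.-integrable D (EFin \o m) -> (forall x, D x -> enorm (h x) <= m x) ->
  enorm (vintegral D h) <= \int[mu]_(x in D) m x.
Proof.
move=> mD ih im hm; set I := vintegral D h.
have m0 : 0 <= \int[mu]_(x in D) m x.
  by apply: Rintegral_ge0 => x Dx; rewrite (le_trans (enorm_ge0 _) (hm x Dx)).
have [->//|I0] := eqVneq (enorm I) 0.
have {}I0 : 0 < enorm I by rewrite lt_def I0 enorm_ge0.
rewrite -(ler_pM2l I0) -RintegralZl// -expr2 enorm_sqr.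
have ihI k : mu.-integrable D (EFin \o (fun x => I 0 k * h x 0 k)).
  exact: (integrableZl mD (I 0 k) (ih k)).
rewrite (_ : \sum_(i < n) _ =
    \int[mu]_(x in D) (\sum_(i < n) I 0 i * h x 0 i)); last first.
  rewrite Rintegral_sum//; apply: eq_bigr => i _.
  rewrite RintegralZl//; last exact: ih.
  by rewrite expr2 {2}/I mxE.
apply: le_Rintegral => //.
- rewrite [X in integrable _ _ X](_ : _ =
    (fun x => \sum_(i < n) (I 0 i * h x 0 i)%:E)%E); last first.
    by apply/funext => x /=; rewrite sumEFin.
  by apply: integrable_sum => // i _; exact: ihI.
- exact: (integrableZl mD (enorm I) im).
- move=> x Dx; apply: le_trans (enorm_cauchy_schwarz _ _) _.
  by rewrite ler_wpM2l ?enorm_ge0// hm.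
Qed.

End VectorIntegral.

(** * Measurability of continuous functions of processes *)

Definition dense_family (R : realType) (S : pseudoMetricType R) (Q : Type)
    (c : Q -> S) : Prop :=
  forall x e, 0 < e -> exists q, ball (c q) e x.

Definition ball_measurable (R : realType) (S : pseudoMetricType R)
    d (Z : measurableType d) (D : set Z) (y : Z -> S) : Prop :=
  forall c e, 0 < e -> measurable (D `&` [set z | ball c e (y z)]).

Section CompactSeparable.
Context (R : realType) (U : metricType R) (u0 : U).

(** A copy of the space with a distinguished point, which the characterization of
    compactness by open covers asks for. *)
Definition pointed_at (u : U) : Type := U.
HB.instance Definition _ := Metric.on (pointed_at u0).
HB.instance Definition _ := isPointed.Build (pointed_at u0) u0.

Lemma compact_finite_net (e : R) : 0 < e -> compact [set: U] ->
  exists s : seq U, forall x, exists2 q, q \in s & ball q e x.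
Proof.
move=> e0 cU; have : compact [set: pointed_at u0] by [].
rewrite compact_cover => /(_ (pointed_at u0) setT
  (fun u => (ball u e)°)) [].
- by move=> i _; exact: open_interior.
- by move=> x _; exists x => //; exact: nbhsx_ballx.
- move=> D _ cov; exists (enum_fset D) => x.
  by have [q qD /interior_subset] := cov x I; exists q.
Qed.

(** Collect finite nets of radius 1/(n+1) over all n. *)
Lemma compact_dense_family : compact [set: U] ->
  exists c : nat * nat -> U, dense_family c.
Proof.
move=> cU.
have : forall n, exists s : seq U, forall x,
    exists2 q, q \in s & ball q (n.+1%:R^-1 : R) x.
  by move=> n; apply: compact_finite_net.
move=> /choice[s sP]; exists (fun k => nth u0 (s k.1) k.2) => x e e0.
have [n ne] := ltr_add_invr e0; rewrite add0r in ne.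
have [q qs xq] := sP n x; exists (n, index q (s n)) => /=.
by rewrite nth_index//; exact: le_ball (ltW ne) _ xq.
Qed.

End CompactSeparable.

Section MeasurableComposition.
Context (R : realType).

Lemma dense_family_real : dense_family (fun q : rat => ratr q : R).
Proof.
move=> x e e0; have xe : x - e < x + e by lra.
have [q] := rat_in_itvoo xe; rewrite in_itv/= => /andP[h1 h2].
by exists q; rewrite /ball/= ltr_norml; lra.
Qed.

Lemma dense_family_row n :
  dense_family (fun q : 'rV[rat]_n => map_mx ratr q : 'rV[R]_n).
Proof.
move=> x e e0.
have /choice[q qP] : forall k : 'I_n, exists q : rat, ball (ratr q : R) e (x 0 k).
  by move=> k; exact: dense_family_real.
exists (\row_k q k); split=> // i j; rewrite !mxE (ord1 i); exact: qP.
Qed.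

Lemma dense_family_pair (S S' : pseudoMetricType R) (Q Q' : Type) (c : Q -> S)
    (c' : Q' -> S') : dense_family c -> dense_family c' ->
  dense_family (fun q : Q * Q' => (c q.1, c' q.2)).
Proof.
move=> hc hc' [x x'] e e0; have [q xq] := hc x _ e0; have [q' xq'] := hc' x' _ e0.
by exists (q, q').
Qed.

Context d (Z : measurableType d) (D : set Z).
Hypothesis mD : measurable D.

Lemma ball_measurable_real (y : Z -> R) :
  measurable_fun D y -> ball_measurable D y.
Proof.
move=> my c e e0; have := my mD _ (measurable_itv `](c - e), (c + e)[).
congr measurable; congr (_ `&` _); apply/seteqP; split=> z /=;
  by rewrite in_itv/= /ball/= ltr_norml; lra.
Qed.

Lemma ball_measurable_row n (y : Z -> 'rV[R]_n) :
  (forall k, measurable_fun D (fun z => y z 0 k)) -> ball_measurable D y.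
Proof.
move=> my c e e0.
rewrite (_ : _ `&` _ =
    \bigcap_(k in [set: 'I_n]) (D `&` [set z | ball (c 0 k) e (y z 0 k)]) `&` D).
  apply: measurableI => //; apply: fin_bigcap_measurable => // k _.
  exact: ball_measurable_real.
apply/seteqP; split=> z.
  by move=> [Dz [_ h]]; split=> // k _; split=> //; exact: h.
move=> [h Dz]; split=> //; split=> // i j; rewrite (ord1 i).
by have [_] := h j I.
Qed.

Lemma ball_measurable_pair (S S' : pseudoMetricType R) (y : Z -> S) (y' : Z -> S') :
  ball_measurable D y -> ball_measurable D y' ->
  ball_measurable D (fun z => (y z, y' z)).
Proof.
move=> my my' [c c'] e e0.
have := measurableI _ _ (my c e e0) (my' c' e e0); congr measurable.
apply/seteqP; split=> z; first by move=> [[Dz h] [_ h']]; split.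
by move=> [Dz [h h']]; split; split.
Qed.

(** The superlevel set is the union of the preimages of those balls of a countable
    family on whose preimage the function exceeds the level. The condition is
    tested at points of the range of [y] only, so that continuity within a set
    containing that range is enough. *)
Lemma measurable_comp_within (S : pseudoMetricType R) (Q : countType) (c : Q -> S)
    (A : set S) (h : S -> R) (y : Z -> S) :
  dense_family c -> {within A, continuous h} -> (forall z, D z -> A (y z)) ->
  ball_measurable D y -> measurable_fun D (h \o y).
Proof.
move=> dc /subspace_continuousP ch yA my _.
apply: (measurability _ (RGenOInfty.measurableE R)) => //.
move=> /= _ [_ [a ->] <-].
pose G (qn : Q * nat) := forall z, D z -> ball (c qn.1) qn.2.+1%:R^-1 (y z) ->
  a < h (y z).
rewrite (_ : _ `&` _ = \bigcup_qn (if `[< G qn >] then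
    D `&` [set z | ball (c qn.1) qn.2.+1%:R^-1 (y z)] else set0)).
  apply: countable_bigcupT_measurable => // qn; case: asboolP => // _.
  by apply: my; rewrite invr_gt0.
apply/seteqP; split=> z; last first.
  move=> [qn _]; case: asboolP => // Gqn [Dz hz]; split=> //=.
  by rewrite in_itv/= andbT; exact: Gqn.
move=> [Dz] /=; rewrite in_itv/= andbT => az.
have : nbhs (y z) [set x | A x -> a < h x].
  exact: (ch _ (yA _ Dz) _ (open_nbhs_nbhs (conj (@open_gt R a) az))).
move=> /nbhs_ballP[e /= e0 eV].
have e20 : 0 < e / 2 by rewrite divr_gt0.
have [n ne] := ltr_add_invr e20; rewrite add0r in ne.
have n0 : 0 < n.+1%:R^-1 :> R by rewrite invr_gt0.
have [q qz] := dc (y z) _ n0.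
exists (q, n) => //; case: asboolP => [//|[]] z' Dz' /= qz'.
apply: (eV (y z')); last exact: yA.
rewrite [e]splitr; apply: (@ball_triangle _ _ (c q)).
  by apply: (le_ball (ltW ne)); exact: ball_sym.
exact: (le_ball (ltW ne)).
Qed.

End MeasurableComposition.

(** * Ordinary differential equations with measurable coefficients *)

Section GeometricSequences.
Context (R : realType).

Lemma half_power_lt (c e : R) : 0 < e -> exists n, c * 2^-1 ^+ n < e.
Proof.
move=> e0; have : geometric c (2^-1 : R) @ \oo --> 0.
  by apply: cvg_geometric; rewrite ger0_norm ?invr_ge0// invf_lt1// ltr1n.
move=> /cvgrPdist_lt/(_ _ e0)[n _ /(_ n (leqnn n))] /=.
rewrite sub0r normrN => h; exists n; exact: le_lt_trans (ler_norm _) h.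
Qed.

Lemma ler_half_power (c x y : R) : (forall n, x <= y + c * 2^-1 ^+ n) -> x <= y.
Proof.
move=> h; apply/ler_addgt0Pl => e e0.
have [n ne] := half_power_lt c e0.
by rewrite (le_trans (h n))// addrC lerD2r ltW.
Qed.

(** The sequence [u n - 2 c 2^-n] increases and [u n + 2 c 2^-n] decreases; the
    limit is any point between them. *)
Lemma half_power_cauchy (u : nat -> R) (c : R) :
  (forall n, `|u n.+1 - u n| <= c * 2^-1 ^+ n) ->
  exists l, forall n, `|u n - l| <= 2 * c * 2^-1 ^+ n.
Proof.
move=> uc; pose w n := 2 * c * 2^-1 ^+ n.
have w0 n : 0 <= w n.
  rewrite /w mulr_ge0// ?exprn_ge0// mulr_ge0//.
  by have := uc 0; rewrite expr0 mulr1; apply: le_trans.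
have wS n : w n.+1 = w n - c * 2^-1 ^+ n by rewrite /w exprS; field.
have lo n m : (n <= m)%N -> u n - w n <= u m - w m.
  elim: m => [|m IH]; first by rewrite leqn0 => /eqP->.
  rewrite leq_eqVlt => /predU1P[->//|/IH]; move=> /le_trans; apply.
  by rewrite wS; have := uc m; rewrite ler_norml; lra.
have hi n m : (n <= m)%N -> u m + w m <= u n + w n.
  elim: m => [|m IH]; first by rewrite leqn0 => /eqP->.
  rewrite leq_eqVlt => /predU1P[->//|/IH]; apply: le_trans.
  by rewrite wS; have := uc m; rewrite ler_norml; lra.
have lohi n m : u n - w n <= u m + w m.
  have h1 := lo n _ (leq_maxl n m); have h2 := hi m _ (leq_maxr n m).
  by have := w0 (maxn n m); lra.
pose E := [set u n - w n | n in setT].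
have E0 : E !=set0 by exists (u 0 - w 0), 0.
exists (sup E) => n; rewrite -/(w n) ler_norml.
have : sup E <= u n + w n by apply: ge_sup => // _ [m _ <-].
have : u n - w n <= sup E.
  by apply: ub_le_sup; [exists (u 0 + w 0) => _ [m _ <-]|exists n].
by move=> *; lra.
Qed.

End GeometricSequences.

Section Field.
Context (R : realType) (d : nat) (a T K C : R).
Hypotheses (aT : a <= T) (K0 : 0 < K).
Local Notation leb := (@lebesgue_measure R).
Implicit Types (F : R -> 'rV[R]_d -> 'rV[R]_d) (X Y : R -> 'rV[R]_d).

(** Measurability is asked along measurable paths: this is what the integral
    equation needs, and it makes sense for fields that are merely measurable in
    time. *)
Record regular_field F : Prop := {
  field_bounded : forall r y, a <= r <= T -> enorm (F r y) <= C ;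
  field_lipschitz : forall r y y', a <= r <= T ->
    enorm (F r y - F r y') <= K * enorm (y - y') ;
  field_measurable : forall Y,
    (forall k, measurable_fun `[a, T] (fun r => Y r 0 k)) ->
    forall k, measurable_fun `[a, T] (fun r => F r (Y r) 0 k) }.

Definition measurable_path Y : Prop :=
  forall k, measurable_fun `[a, T] (fun r => Y r 0 k).

Definition picard_map F (x : 'rV[R]_d) Y (s : R) : 'rV[R]_d :=
  x + vintegral leb `[a, s] (fun r => F r (Y r)).

Definition solves F (x : 'rV[R]_d) X : Prop :=
  {within `[a, T], continuous X} /\
  forall s, a <= s <= T -> X s = picard_map F x X s.

(** Weight for which the integral operator is a contraction of ratio 1/2 on the
    whole interval, with no restriction on its length. *)
Definition weight (s : R) : R := expR (2 * K * (s - a)).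

Lemma weight_gt0 s : 0 < weight s. Proof. exact: expR_gt0. Qed.

Lemma weight_ge1 s : a <= s -> 1 <= weight s.
Proof.
by move=> as_; rewrite -expR0 ler_expR mulr_ge0 ?subr_ge0// mulr_ge0// ltW.
Qed.

Lemma continuous_weight : continuous weight.
Proof.
move=> s; apply: differentiable_continuous; apply/derivable1_diffP.
exact: ex_derive.
Qed.

Lemma integral_weight_le s : a <= s ->
  \int[leb]_(r in `[a, s]) weight r <= weight s / (2 * K).
Proof.
have K20 : 0 < 2 * K by rewrite mulr_gt0.
rewrite le_eqVlt => /predU1P[<-|as_].
  by rewrite set_itv1 Rintegral_set1 divr_ge0 ?ltW// weight_gt0.
rewrite /Rintegral.
rewrite (@continuous_FTC2 _ weight (fun r => weight r / (2 * K)) a s) //.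
- by rewrite -EFinB /= lerBlDr lerDl divr_ge0 ?ltW// weight_gt0.
- exact/continuous_subspaceT/continuous_weight.
- have cw : continuous (fun r => weight r / (2 * K)).
    by move=> r; apply: cvgM; [exact: continuous_weight|exact: cvg_cst].
  split; first by move=> r _; exact: ex_derive.
  + exact/cvg_at_right_filter/cw.
  + exact/cvg_at_left_filter/cw.
- move=> r _; rewrite derive1E.
  have h : is_derive r (1 : R) (fun r => expR (2 * K * (r - a)) / (2 * K))
      (expR (2 * K * (r - a))).
    by apply: is_derive_eq; rewrite /GRing.scale/=; field; rewrite gt_eqF.
  exact: derive_val.
Qed.

Lemma integral_itv_finite (s s' : R) : (leb `[s, s'] < +oo)%E.
Proof.
by rewrite lebesgue_measure_itv/=; case: ifP => // _; rewrite -EFinB ltry.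
Qed.

Section FixedField.
Variable F : R -> 'rV[R]_d -> 'rV[R]_d.
Hypothesis rF : regular_field F.

Lemma field_integrable Y s s' k : measurable_path Y -> a <= s -> s' <= T ->
  leb.-integrable `[s, s'] (fun r => (F r (Y r) 0 k)%:E).
Proof.
move=> mY as_ sT'.
have ss : `[s, s'] `<=` `[a, T] by apply: subset_itvScc; rewrite bnd_simp.
apply: (@bounded_integrable _ _ _ _ _ _ C) => //.
- exact: integral_itv_finite.
- exact: measurable_funS (field_measurable rF mY k).
- move=> r /ss; rewrite /= in_itv/= => arT.
  by apply: le_trans (ler_enorm _ _) _; exact: (field_bounded rF).
Qed.

Lemma field_bound_ge0 : 0 <= C.
Proof.
apply: le_trans (enorm_ge0 _) (field_bounded rF (r := a) 0 _).
by rewrite lexx.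
Qed.

Lemma vintegral_field_le Y s s' : measurable_path Y -> a <= s -> s <= s' ->
  s' <= T -> enorm (vintegral leb `[s, s'] (fun r => F r (Y r))) <= C * (s' - s).
Proof.
move=> mY as_ ss' sT'.
have -> : C * (s' - s) = \int[leb]_(r in `[s, s']) C.
  rewrite Rintegral_cst//= lebesgue_measure_itv/= lte_fin.
  move: ss'; rewrite le_eqVlt => /predU1P[->|ss']; first by rewrite ltxx subrr.
  by rewrite ss'.
apply: enorm_vintegral_le => //.
- by move=> k; exact: field_integrable.
- apply: (@bounded_integrable _ _ _ _ _ _ `|C|) => //.
  exact: integral_itv_finite.
- move=> r; rewrite /= in_itv/= => /andP[sr rs]; apply: (field_bounded rF).
  by rewrite (le_trans as_ sr) (le_trans rs sT').
Qed.

(** The factor 1/2 comes from [integral_weight_le]: the Lipschitz constant [K] is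
    cancelled by the primitive of the weight, which is at most weight / (2 K). *)
Lemma picard_map_contracts x x' Y Y' M s : measurable_path Y ->
  measurable_path Y' -> a <= s <= T ->
  (forall r, a <= r <= s -> enorm (Y r - Y' r) <= M * weight r) ->
  enorm (picard_map F x Y s - picard_map F x' Y' s) <=
    enorm (x - x') + M / 2 * weight s.
Proof.
move=> mY mY' /andP[as_ sT] YM.
have iF Z k : measurable_path Z ->
    leb.-integrable `[a, s] (EFin \o (fun r => F r (Z r) 0 k)).
  by move=> mZ; exact: field_integrable.
rewrite /picard_map opprD addrACA; apply: le_trans (ler_enormD _ _) _.
rewrite lerD2l.
have -> : vintegral leb `[a, s] (fun r => F r (Y r)) -
    vintegral leb `[a, s] (fun r => F r (Y' r)) =
    vintegral leb `[a, s] (fun r => F r (Y r) - F r (Y' r)).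
  apply/rowP => k; rewrite !mxE -RintegralB//; try exact: iF.
  by apply: eq_Rintegral => r _; rewrite !mxE.
have M0 : 0 <= M.
  have := YM a; rewrite lexx as_ => /(_ isT)/(le_trans (enorm_ge0 _)).
  by rewrite pmulr_lge0// weight_gt0.
have iw : leb.-integrable `[a, s] (EFin \o weight).
  apply: continuous_compact_integrable; first exact: segment_compact.
  exact/continuous_subspaceT/continuous_weight.
apply: (@le_trans _ _ (\int[leb]_(r in `[a, s]) (K * M * weight r))); last first.
  rewrite RintegralZl//.
  apply: le_trans (ler_wpM2l _ (integral_weight_le as_)) _.
    by rewrite mulr_ge0// ltW.
  by rewrite le_eqVlt; apply/orP; left; apply/eqP; field; rewrite gt_eqF.
apply: enorm_vintegral_le => //.
- move=> k.
  rewrite [X in integrable _ _ X](_ : _ = (fun r => (F r (Y r) 0 k)%:E -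
      (F r (Y' r) 0 k)%:E)%E); last by apply/funext => r; rewrite !mxE EFinB.
  by apply: integrableB => //; exact: iF.
- exact: (integrableZl _ (K * M) iw).
- move=> r; rewrite /= in_itv/= => /andP[ar rs].
  have arT : a <= r <= T by rewrite ar (le_trans rs sT).
  apply: le_trans (field_lipschitz rF _ _ arT) _.
  by rewrite -mulrA ler_pM2l// YM// ar.
Qed.

Lemma continuous_measurable_path X :
  {within `[a, T], continuous X} -> measurable_path X.
Proof.
move=> cX k; apply: subspace_continuous_measurable_fun => //.
move=> r; exact: (@continuous_comp (subspace `[a, T]) _ _ X
  (fun y : 'rV[R]_d => y 0 k) r (cX r) (@coord_continuous _ _ _ 0 k (X r))).
Qed.

(** The a priori bound 2 C (T - a) on the distance of the paths is halved by each
    application of the Picard map, while the initial error e is reproduced: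
    e + (2 e) / 2 = 2 e. *)
Lemma solves_stable x x' X X' s : solves F x X -> solves F x' X' ->
  a <= s <= T -> enorm (X s - X' s) <= 2 * enorm (x - x') * weight s.
Proof.
move=> [cX eX] [cX' eX'].
have mX := continuous_measurable_path cX.
have mX' := continuous_measurable_path cX'.
have n0 := enorm_ge0 (x - x').
suff H n s' : a <= s' <= T -> enorm (X s' - X' s') <=
    (2 * enorm (x - x') + 2 * C * (T - a) * 2^-1 ^+ n) * weight s'.
  move=> asT; rewrite -ler_pdivrMr ?weight_gt0//.
  apply: (@ler_half_power _ (2 * C * (T - a))) => n.
  by rewrite ler_pdivrMr ?weight_gt0// H.
elim: n s' => [|n IH] s' /andP[as' sT'].
  have w1 := weight_ge1 as'.
  have h (Z : R -> 'rV[R]_d) : measurable_path Z ->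
      enorm (vintegral leb `[a, s'] (fun r => F r (Z r))) <= C * (T - a).
    move=> mZ; apply: le_trans (vintegral_field_le mZ (lexx a) as' sT') _.
    by rewrite ler_wpM2l ?field_bound_ge0// lerD2r.
  rewrite expr0 mulr1; apply: (@le_trans _ _ (enorm (x - x') + 2 * C * (T - a))).
    rewrite eX ?eX' ?as'// /picard_map opprD addrACA.
    apply: le_trans (ler_enormD _ _) _; rewrite lerD2l.
    apply: le_trans (ler_enormD _ _) _; rewrite enormN.
    by have := h X mX; have := h X' mX'; lra.
  have c0 : 0 <= 2 * C * (T - a).
    by rewrite mulr_ge0 ?subr_ge0// mulr_ge0// field_bound_ge0.
  by apply: le_trans (ler_wpM2l _ w1); rewrite ?mulr1; lra.
rewrite eX ?eX' ?as'//.
apply: le_trans (picard_map_contracts x x' mX mX' _ _) _; first exact/andP.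
  by move=> r /andP[ar rs]; apply: IH; rewrite ar (le_trans rs sT').
rewrite -/(weight s').
apply: (@le_trans _ _ (enorm (x - x') * weight s' +
    (2 * enorm (x - x') + 2 * C * (T - a) * 2^-1 ^+ n) / 2 * weight s')).
  by rewrite lerD2r ler_peMr// weight_ge1.
by rewrite le_eqVlt; apply/orP; left; apply/eqP; rewrite exprS; field.
Qed.

(** A measurable path obeying the integral equation is Lipschitz, since the field
    is bounded. *)
Lemma solves_of_equation x X : measurable_path X ->
  (forall s, a <= s <= T -> X s = picard_map F x X s) -> solves F x X.
Proof.
move=> mX eX; split=> //.
have lip s s' : a <= s -> s <= s' -> s' <= T -> enorm (X s' - X s) <= C * (s' - s).
  move=> as_ ss' sT'.
  rewrite eX ?(le_trans as_)// (eX s) ?as_ ?(le_trans ss')// /picard_map.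
  rewrite opprD addrACA subrr add0r.
  rewrite (_ : _ - _ = vintegral leb `[s, s'] (fun r => F r (X r))).
    exact: vintegral_field_le.
  apply/rowP => k; rewrite !mxE Rintegral_itvB ?bnd_simp//.
    rewrite Rintegral_itv_obnd_cbnd//.
    refine (integrableS _ _ _ (field_integrable k mX as_ sT')) => //.
    by apply: subset_itvr; rewrite bnd_simp.
  by apply: field_integrable.
apply/subspace_continuousP => s /=; rewrite in_itv/= => /andP[as_ sT].
apply/cvg_ballP => e e0.
have C10 : 0 < C + 1 by rewrite ltr_wpDl ?field_bound_ge0.
have := nbhsx_ballx s (e / (C + 1)) (divr_gt0 e0 C10).
rewrite near_withinE; apply: filterS => s' /= ss'.
rewrite in_itv/= => /andP[as' sT'].
split=> // i k; rewrite (ord1 i) /ball/=.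
have -> : X s 0 k - X s' 0 k = (X s - X s') 0 k by rewrite !mxE.
apply: le_lt_trans (ler_enorm _ _) _.
apply: (@le_lt_trans _ _ (C * `|s - s'|)).
  have [le|/ltW le] := leP s s'.
    by rewrite enormB distrC ger0_norm ?subr_ge0// lip.
  by rewrite ger0_norm ?subr_ge0// lip.
rewrite /ball/= ltr_pdivlMr// in ss'; apply: le_lt_trans ss'; rewrite mulrC ler_wpM2l//.
by rewrite lerDl.
Qed.

End FixedField.

End Field.

Section AlmostEverywhere.
Context d (S : measurableType d) (R : realType) (mu : {measure set S -> \bar R}).

Lemma ae_mono (P Q : S -> Prop) : (forall x, P x -> Q x) ->
  {ae mu, forall x, P x} -> {ae mu, forall x, Q x}.
Proof. by move=> PQ; apply: filterS. Qed.

Lemma ae_mono2 (P1 P2 Q : S -> Prop) : (forall x, P1 x -> P2 x -> Q x) ->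
  {ae mu, forall x, P1 x} -> {ae mu, forall x, P2 x} -> {ae mu, forall x, Q x}.
Proof. by move=> PQ; apply: filterS2. Qed.

Lemma ae_mono3 (P1 P2 P3 Q : S -> Prop) :
  (forall x, P1 x -> P2 x -> P3 x -> Q x) ->
  {ae mu, forall x, P1 x} -> {ae mu, forall x, P2 x} ->
  {ae mu, forall x, P3 x} -> {ae mu, forall x, Q x}.
Proof. by move=> PQ; apply: filterS3. Qed.

End AlmostEverywhere.

Section ChangeOfField.
Context (R : realType) (d : nat) (T K C : R).
Hypothesis (K0 : 0 < K).
Local Notation leb := (@lebesgue_measure R).
Implicit Types (F : R -> 'rV[R]_d -> 'rV[R]_d) (X Y : R -> 'rV[R]_d).

Lemma solves_restart F (a a' : R) x X : a <= a' <= T -> regular_field a T K C F ->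
  solves a T F x X -> solves a' T F (X a') X.
Proof.
move=> /andP[aa' aT'] rF [cX eX]; have aT := le_trans aa' aT'.
have mX := continuous_measurable_path cX.
split.
  by apply: continuous_subspaceW cX; apply: subset_itvr; rewrite bnd_simp.
move=> s /andP[as' sT]; have as_ := le_trans aa' as'.
rewrite eX ?as_// (eX a') ?aa'// /picard_map -addrA; congr (_ + _).
apply/rowP => k; rewrite !mxE [RHS]addrC; apply/eqP; rewrite -subr_eq; apply/eqP.
rewrite Rintegral_itvB ?bnd_simp//.
  rewrite Rintegral_itv_obnd_cbnd//.
  refine (integrableS _ _ _ (field_integrable rF k mX aa' sT)) => //.
  by apply: subset_itvr; rewrite bnd_simp.
exact: (field_integrable rF k mX).
Qed.

Lemma solves_ae_eq F F' (a : R) x X : a <= T -> regular_field a T K C F ->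
  regular_field a T K C F' ->
  {ae leb, forall r, a <= r <= T -> forall y, F r y = F' r y} ->
  solves a T F x X -> solves a T F' x X.
Proof.
move=> aT rF rF' FF' [cX eX]; split=> // s /andP[as_ sT].
have mX := continuous_measurable_path cX.
rewrite eX ?as_// /picard_map; congr (_ + _); apply/rowP => k; rewrite !mxE.
congr fine; apply: ae_eq_integral => //.
- exact: (measurable_int leb (field_integrable rF k mX (lexx a) sT)).
- exact: (measurable_int leb (field_integrable rF' k mX (lexx a) sT)).
apply: ae_mono FF' => r h /=; rewrite in_itv/= => /andP[ar rs].
by rewrite h// ar (le_trans rs).
Qed.

(** On the overlap of the two time intervals both paths solve the same equation,
    started from points that the boundedness of the field keeps close. *)
Lemma solves_compare F F' (a a' : R) x x' X X' : a <= a' <= T ->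
  regular_field a T K C F -> regular_field a' T K C F ->
  regular_field a' T K C F' ->
  {ae leb, forall r, a' <= r <= T -> forall y, F r y = F' r y} ->
  solves a T F x X -> solves a' T F' x' X' ->
  enorm (X T - X' T) <=
    2 * (enorm (x - x') + C * (a' - a)) * expR (2 * K * (T - a')).
Proof.
move=> /andP[aa' aT'] rF rF1 rF' FF' sX sX'.
have aT := le_trans aa' aT'.
have s1 := solves_ae_eq aT' rF1 rF' FF' (solves_restart _ rF sX).
have {}s1 : solves a' T F' (X a') X by apply: s1; rewrite aa'.
have := solves_stable aT' K0 rF' s1 sX' (s := T).
rewrite aT' lexx => /(_ isT)/le_trans; apply.
rewrite ler_pM2r ?expR_gt0// ler_pM2l//.
apply: le_trans (ler_enorm_distD _ x _) _; rewrite addrC lerD2l.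
have [cX eX] := sX; have mX := continuous_measurable_path cX.
rewrite eX ?aa'// /picard_map addrC addKr.
exact: (vintegral_field_le rF mX (lexx a) aa' aT').
Qed.

End ChangeOfField.

Section ParametrizedEquation.
Context (R : realType) (d : nat) (a T K C : R).
Hypotheses (aT : a <= T) (K0 : 0 < K).
Context dw (W : measurableType dw).
Local Notation leb := (@lebesgue_measure R).
Variable F : W -> R -> 'rV[R]_d -> 'rV[R]_d.
Let D : set (R * W) := [set z | a <= z.1 <= T].

Lemma measurable_strip (b c : R) : measurable [set z : R * W | b <= z.1 <= c].
Proof.
rewrite (_ : [set z | _] = setT `&` fst @^-1` `[b, c]%classic).
  exact: (@measurable_fst _ _ R W measurableT).
by rewrite setTI; apply/seteqP; split=> z /=; rewrite in_itv.
Qed.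

Lemma measurable_section_path (h : R * W -> R) w :
  measurable_fun D h -> measurable_fun `[a, T] (fun r => h (r, w)).
Proof.
move=> mh; apply: (@measurable_comp _ _ _ _ _ _ D h _ (fun r => (r, w))) => //.
- exact: measurable_strip.
- by move=> _ [r /= + <-]; rewrite in_itv.
- exact: (measurableT_comp (pair2_measurable w)).
Qed.

(** Adding the bound [M] to [h] and restricting to the triangle r <= s turns the
    indefinite integral into the inner integral of a nonnegative function of
    (s, w, r), measurable by Tonelli; the shift is then subtracted. *)
Lemma measurable_indefinite_integral (h : R * W -> R) (M : R) :
  measurable_fun D h -> (forall z, D z -> `|h z| <= M) ->
  measurable_fun D (fun z => \int[leb]_(r in `[a, z.1]) h (r, z.2)).
Proof.
move=> mh hM.
have mD : measurable D by exact: measurable_strip.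
pose swap (y : (R * W) * R) : R * W := (y.2, y.1.2).
have mswap : measurable_fun setT swap.
  apply: measurable_fun_pair => //.
  exact: (measurableT_comp measurable_snd measurable_fst).
pose E := [set y : (R * W) * R | a <= y.2 <= y.1.1 /\ y.1.1 <= T].
have mE : measurable E.
  rewrite (_ : E = [set y | a <= y.2] `&` [set y | y.2 <= y.1.1] `&` [set y | y.1.1 <= T]).
    have m1 : measurable_fun setT (fun y : (R * W) * R => y.1.1).
      exact: (measurableT_comp measurable_fst measurable_fst).
    have m2 : measurable_fun setT (fun y : (R * W) * R => y.2).
      exact: measurable_snd.
    have ml (p q : (R * W) * R -> R) : measurable_fun setT p ->
      measurable_fun setT q -> measurable [set y | p y <= q y].
      move=> mp mq; rewrite -[X in measurable X]setTI.
      have -> : [set y | p y <= q y] = (fun y => p y <= q y) @^-1` [set true].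
        by apply/seteqP; split=> y /=.
      exact: measurable_fun_ler.
    have mc (b : R) : measurable_fun setT (fun _ : (R * W) * R => b) by [].
    apply: measurableI; first apply: measurableI.
    - exact: (ml _ _ (mc a) m2).
    - exact: (ml _ _ m2 m1).
    - exact: (ml _ _ m1 (mc T)).
  apply/seteqP; split=> y.
    by move=> [/andP[? ?] ?].
  by move=> [[/= ? ?] ?]; split=> //; apply/andP.
have ED y : E y -> D (swap y).
  by move=> [/andP[ay yy] yT]; rewrite /D/= ay (le_trans yy).
pose H := ((fun y => h (swap y) + M) \_ E).
have mH : measurable_fun setT H.
  apply/(measurable_restrictT _ mE).
  apply: measurable_funD => //.
  apply: (@measurable_comp _ _ _ _ _ _ D) => //; last exact: measurable_funTS.
  by move=> _ [y Ey <-]; exact: ED.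
have H0 y : (0 <= (H y)%:E)%E.
  rewrite lee_fin /H patchE; case: ifPn => // /set_mem/ED/hM.
  by rewrite ler_norml; lra.
have mEH : measurable_fun setT (EFin \o H) by exact/measurable_EFinP.
have mI := @measurable_fun_fubini_tonelli_F _ _ (R * W)%type (measurableTypeR R) R leb
  (EFin \o H) mEH H0.
apply: (eq_measurable_fun
    (fun z => fine (fubini_F leb (EFin \o H) z) - M * (z.1 - a))); last first.
  apply: measurable_funTS; apply: measurable_funB; first exact: measurableT_comp.
  by apply: measurable_funM => //; apply: measurable_funB.
move=> z /set_mem Dz; have /andP[az zT] := Dz.
have mhz : measurable_fun `[a, z.1] (fun r => h (r, z.2)).
  apply: (measurable_funS _ _ (measurable_section_path z.2 mh)) => //.
  by apply: subset_itvScc; rewrite bnd_simp.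
have bhz r : r \in `[a, z.1] -> `|h (r, z.2)| <= M.
  by rewrite in_itv/= => /andP[ar rz]; apply: hM; rewrite /D/= ar (le_trans rz).
have -> : fubini_F leb (EFin \o H) z =
    (\int[leb]_(r in `[a, z.1]) (h (r, z.2) + M)%:E)%E.
  rewrite /fubini_F [RHS]integral_mkcond; apply: eq_integral => r _ /=.
  rewrite /H !patchE.
  have -> : ((z, r) \in E) = (r \in `[a, z.1]%classic).
    apply/idP/idP => /set_mem h'; apply/mem_set.
      by case: h' => h' _; rewrite /= in_itv.
    by move: h'; rewrite /E /= in_itv.
  by case: ifP.
have fin : (leb `[a, z.1] < +oo)%E by exact: integral_itv_finite.
rewrite -/(Rintegral _ _ _) RintegralD//.
- rewrite Rintegral_cst//= lebesgue_measure_itv/= lte_fin.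
  move: az; rewrite le_eqVlt => /predU1P[<-|az]; first by rewrite ltxx subrr /=; ring.
  by rewrite az /=; ring.
- exact: (bounded_integrable _ fin mhz bhz).
- by apply: (@bounded_integrable _ _ _ _ _ _ `|M|).
Qed.

Hypothesis F_bounded : forall w r y, a <= r <= T -> enorm (F w r y) <= C.
Hypothesis F_lipschitz : forall w r y y', a <= r <= T ->
  enorm (F w r y - F w r y') <= K * enorm (y - y').
Hypothesis F_measurable : forall Y : R * W -> 'rV[R]_d,
  (forall k, measurable_fun D (fun z => Y z 0 k)) ->
  forall k, measurable_fun D (fun z => F z.2 z.1 (Y z) 0 k).

Lemma regular_field_section w : regular_field a T K C (F w).
Proof.
split=> [r y|r y y'|Y mY k]; [exact: F_bounded|exact: F_lipschitz|].
have mYD j : measurable_fun D (fun z => Y z.1 0 j).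
  apply: (@measurable_comp _ _ _ _ _ _ `[a, T]%classic (fun r => Y r 0 j)) => //.
  - by move=> _ [z /= Dz <-]; rewrite in_itv.
  - by apply: measurable_funTS; exact: measurable_fst.
exact: measurable_section_path w (F_measurable mYD k).
Qed.

(** Picard's iterates, as functions of time and parameter jointly. *)
Fixpoint picard (x : 'rV[R]_d) (n : nat) (z : R * W) : 'rV[R]_d :=
  if n is m.+1 then picard_map a (F z.2) x (fun r => picard x m (r, z.2)) z.1
  else x.

Lemma measurable_picard x n k : measurable_fun D (fun z => picard x n z 0 k).
Proof.
elim: n k => [|n IH] k; first exact: measurable_cst.
rewrite /= /picard_map.
under eq_fun do rewrite !mxE.
apply: measurable_funD => //.
apply: (measurable_indefinite_integral (M := C)
  (h := fun z => F z.2 z.1 (picard x n z) 0 k)).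
  exact: (F_measurable IH k).
by move=> z Dz; apply: le_trans (ler_enorm _ _) _; exact: F_bounded.
Qed.

Lemma picard_cauchy x n s w : a <= s <= T ->
  enorm (picard x n.+1 (s, w) - picard x n (s, w)) <=
    C * (T - a) * 2^-1 ^+ n * weight a K s.
Proof.
have rF := regular_field_section w.
have mP m : measurable_path a T (fun r => picard x m (r, w)).
  by move=> k; exact: measurable_section_path w (measurable_picard x m k).
elim: n s => [|n IH] s /andP[as_ sT].
  rewrite expr0 mulr1 /= /picard_map/= addrAC subrr add0r.
  apply: le_trans (vintegral_field_le rF (mP 0%N) (lexx a) as_ sT) _.
  have c0 := field_bound_ge0 aT rF.
  apply: (@le_trans _ _ (C * (T - a) * 1)).
    by rewrite mulr1 ler_wpM2l// lerD2r.
  by rewrite ler_wpM2l ?mulr_ge0 ?subr_ge0// (weight_ge1 K0).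
have asT : a <= s <= T by rewrite as_.
have := @picard_map_contracts _ _ a T K C K0 _ rF x x _ _
  (C * (T - a) * 2^-1 ^+ n) s (mP n.+1) (mP n) asT.
rewrite subrr enorm0 add0r [2^-1 ^+ n.+1]exprSr mulrA; apply.
by move=> r /andP[ar rs]; apply: IH; rewrite ar (le_trans rs).
Qed.

(** The parameter enters through Picard's iterates, which are jointly measurable;
    so is their limit. *)
Lemma exists_measurable_solution (x : 'rV[R]_d) :
  exists X : R * W -> 'rV[R]_d,
    (forall w, solves a T (F w) x (fun s => X (s, w))) /\
    forall k, measurable_fun setT (fun w => X (T, w) 0 k).
Proof.
have w1 s : a <= s -> 1 <= weight a K s by exact: weight_ge1.
have [w0|] := pselect (exists w0 : W, True); last first.
  move=> nW; exists (fun=> 0); split=> [w|k].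
    by exfalso; apply: nW; exists w.
  by apply: measurable_cst.
have C0 : 0 <= C * (T - a).
  case: w0 => w _.
  by rewrite mulr_ge0 ?subr_ge0// (field_bound_ge0 aT (regular_field_section w)).
have cT z : D z -> C * (T - a) * weight a K z.1 <= C * (T - a) * weight a K T.
  move=> /andP[_ zT]; rewrite ler_wpM2l// ler_expR ler_wpM2l//; last by rewrite lerD2r.
  by rewrite mulr_ge0// ltW.
pose c := 2 * (C * (T - a) * weight a K T).
have c0 : 0 <= c by rewrite mulr_ge0// mulr_ge0// ltW// expR_gt0.
have lim z : exists l : 'rV[R]_d, D z ->
    forall k n, `|picard x n z 0 k - l 0 k| <= c * 2^-1 ^+ n.
  have [Dz|nDz] := pselect (D z); last by exists 0.
  have /choice[l lP] : forall k : 'I_d, exists l : R,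
      forall n, `|picard x n z 0 k - l| <= c * 2^-1 ^+ n.
    move=> k; apply: half_power_cauchy => n; rewrite -/c.
    have -> : picard x n.+1 z 0 k - picard x n z 0 k =
      (picard x n.+1 z - picard x n z) 0 k by rewrite !mxE.
    apply: le_trans (ler_enorm _ _) _.
    case: z Dz => s w Dz; apply: le_trans (picard_cauchy x n w Dz) _.
    by rewrite mulrAC ler_wpM2r ?exprn_ge0// cT.
  by exists (\row_k l k) => _ k n; rewrite mxE.
have {lim}[X XP] := choice lim.
have mX k : measurable_fun D (fun z => X z 0 k).
  apply: (measurable_fun_cvg (h := fun n z => picard x n z 0 k)).
    by move=> n; exact: measurable_picard.
  move=> z Dz; apply/cvgrPdist_lt => e e0.
  have [n ne] := half_power_lt c e0.
  exists n => // m /= nm; rewrite distrC.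
  apply: le_lt_trans (XP z Dz k m) (le_lt_trans _ ne).
  by rewrite ler_wpM2l// ler_wiXn2l// invf_le1// ler1n.
have near n z : D z -> enorm (picard x n z - X z) <= d%:R * c * 2^-1 ^+ n.
  move=> Dz; apply: le_trans (ler_enorm_sum _) _.
  rewrite -mulrA mulr_natl -[in leRHS](card_ord d) -sumr_const.
  by apply: ler_sum => k _; rewrite !mxE XP.
exists X; split=> [w|k]; last first.
  apply: (@measurable_comp _ _ _ _ _ _ D (fun z => X z 0 k) _ (fun w => (T, w))) => //.
  - exact: measurable_strip.
  - by move=> _ [w _ <-]; rewrite /D/= aT lexx.
  - exact: pair1_measurable.
have rF := regular_field_section w.
have mXw : measurable_path a T (fun r => X (r, w)).
  by move=> k; exact: measurable_section_path w (mX k).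
have mP m : measurable_path a T (fun r => picard x m (r, w)).
  by move=> k; exact: measurable_section_path w (measurable_picard x m k).
apply: (solves_of_equation aT rF mXw) => s asT; apply/eqP; rewrite -subr_eq0.
apply/eqP/enorm_eq0/eqP; rewrite eq_le enorm_ge0 andbT.
apply: (@ler_half_power _ (d%:R * c * (1 + weight a K s))) => n; rewrite add0r.
apply: le_trans (ler_enorm_distD _ (picard x n.+1 (s, w)) _) _.
have dc0 : 0 <= d%:R * c * 2^-1 ^+ n by rewrite mulr_ge0 ?exprn_ge0// mulr_ge0.
have h1 : enorm (X (s, w) - picard x n.+1 (s, w)) <= d%:R * c * 2^-1 ^+ n.
  rewrite enormB; apply: le_trans (near n.+1 (s, w) asT) _.
  rewrite ler_wpM2l //; first by rewrite mulr_ge0.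
  by rewrite ler_wiXn2l// invf_le1// ler1n.
have h2 := @picard_map_contracts _ _ a T K C K0 _ rF x x _ _
  (d%:R * c * 2^-1 ^+ n) s (mP n) mXw asT.
have {}h2 : enorm (picard x n.+1 (s, w) - picard_map a (F w) x (fun r => X (r, w)) s) <=
    d%:R * c * 2^-1 ^+ n * weight a K s.
  apply: le_trans (h2 _) _.
    move=> r /andP[ar rs]; apply: le_trans (near n (r, w) _) _.
      by rewrite /D/= ar; case/andP: asT => _; exact: le_trans rs.
    by rewrite ler_peMr// w1.
  rewrite subrr enorm0 add0r ler_wpM2r// ?(ltW (weight_gt0 _ _ _))//.
  by rewrite ler_pdivrMr// ler_peMr// ler1n.
apply: le_trans (lerD h1 h2) _.
by rewrite le_eqVlt; apply/orP; left; apply/eqP; ring.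
Qed.

End ParametrizedEquation.

(** * Conditional expectations *)

Section IntegralComparison.
Context (R : realType) d (S : measurableType d) (mu : {measure set S -> \bar R}).
Implicit Types (X Y : S -> R) (A : set S).

Lemma ae_eq_Rintegral X Y A : measurable A ->
  measurable_fun A X -> measurable_fun A Y ->
  {ae mu, forall w, A w -> X w = Y w} ->
  \int[mu]_(w in A) X w = \int[mu]_(w in A) Y w.
Proof.
move=> mA mX mY XY; congr fine; apply: ae_eq_integral => //.
- exact/measurable_EFinP.
- exact/measurable_EFinP.
- by apply: ae_mono XY => w h Aw /=; rewrite h.
Qed.

Lemma ae_le_Rintegral X Y A : measurable A ->
  mu.-integrable A (EFin \o X) -> mu.-integrable A (EFin \o Y) ->
  {ae mu, forall w, A w -> X w <= Y w} ->
  \int[mu]_(w in A) X w <= \int[mu]_(w in A) Y w.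
Proof.
move=> mA iX iY XY.
have mX : measurable_fun A X by exact/measurable_EFinP/(measurable_int mu).
have mY : measurable_fun A Y by exact/measurable_EFinP/(measurable_int mu).
have mM : measurable_fun A (fun w => Num.max (X w) (Y w)).
  exact: measurable_maxr.
have YM : ae_eq mu A (EFin \o Y) (EFin \o (fun w => Num.max (X w) (Y w))).
  by apply: ae_mono XY => w h Aw /=; rewrite max_r// h.
have iM : mu.-integrable A (EFin \o (fun w => Num.max (X w) (Y w))).
  apply: (le_integrable mA _ _ (integrableD mA (integrable_abse iX) (integrable_abse iY))).
    exact/measurable_EFinP.
  move=> w _ /=; rewrite lee_fin.
  rewrite [leRHS]ger0_norm ?addr_ge0//.
  by case: (leP (X w) (Y w)) => _; rewrite ?lerDl ?lerDr.
rewrite [leRHS](_ : _ = \int[mu]_(w in A) Num.max (X w) (Y w)).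
  by apply: le_Rintegral => // w _; rewrite le_max lexx.
by congr fine; apply: ae_eq_integral => //; exact/measurable_EFinP.
Qed.

(** A nonnegative function with nonpositive integral vanishes almost everywhere. *)
Lemma le_Rintegral_ae_eq X Y A : measurable A ->
  mu.-integrable A (EFin \o X) -> mu.-integrable A (EFin \o Y) ->
  (forall w, A w -> X w <= Y w) ->
  \int[mu]_(w in A) Y w <= \int[mu]_(w in A) X w ->
  {ae mu, forall w, A w -> X w = Y w}.
Proof.
move=> mA iX iY XY le.
have mYX : measurable_fun A (fun w => (Y w - X w)%:E).
  by have := integrableB mA iY iX; exact: measurable_int.
have : (\int[mu]_(w in A) `|(Y w - X w)%:E| = 0)%E.
  transitivity (\int[mu]_(w in A) (Y w - X w)%:E)%E.
    apply: eq_integral => w /set_mem/XY h.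
    by rewrite gee0_abs// lee_fin subr_ge0.
  have ifi : (\int[mu]_(w in A) (Y w - X w)%:E)%E \is a fin_num.
    apply: integrable_fin_num => //; exact: (integrableB mA iY iX).
  rewrite -(fineK ifi) -/(Rintegral _ _ _) RintegralB//; congr EFin.
  by apply/eqP; rewrite eq_le subr_le0 le subr_ge0 le_Rintegral.
move=> /(ae_eq_integral_abs mu mA mYX); apply: ae_mono => w /= h Aw.
by move: (h Aw) => [] /eqP; rewrite subr_eq0 => /eqP.
Qed.

End IntegralComparison.

Section FactorizedExpectation.
Context (R : realType) d (S : measurableType d) d' (S' : measurableType d').
Context (P : probability S R) (phi : {mfun S >-> S'}).

(** The indefinite integral of [Y], transported by [phi], has a density with
    respect to the law of [phi]; this density composed with [phi] is the
    conditional expectation. *)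
Lemma factorized_expectation (Y : S -> R) : P.-integrable setT (EFin \o Y) ->
  exists Z : S' -> R, [/\ measurable_fun setT Z,
    P.-integrable setT (EFin \o (Z \o phi)) &
    forall A, measurable A ->
      (\int[P]_(w in phi @^-1` A) (Z (phi w))%:E =
       \int[P]_(w in phi @^-1` A) (Y w)%:E)%E].
Proof.
move=> iY.
have mphi : measurable_fun setT phi by [].
have mpre A : measurable A -> measurable (phi @^-1` A).
  by move=> mA; rewrite -[X in measurable X]setTI; exact: mphi.
pose mu := distribution P phi.
pose nu := measure_function_pushforward__canonical__charge_Charge (induced_charge iY) mphi.
have numu : nu `<< mu.
  apply/null_content_dominatesP => A mA muA.
  have mpA := mpre A mA.
  apply: null_set_integral => //.
  exact: measurable_funTS (measurable_int P iY).
have ih := Radon_Nikodym_integrable numu.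
set h := Radon_Nikodym _ _ in ih.
have hfin x : h x \is a fin_num by exact: Radon_Nikodym_fin_num.
have mh : measurable_fun setT h by exact: measurable_int ih.
have EZ : EFin \o ((fine \o h) \o phi) = h \o phi.
  by apply/funext => w /=; rewrite fineK.
have iZ : P.-integrable setT (h \o phi).
  apply/integrableP; split; first exact: measurableT_comp.
  move/integrableP : ih => [_]; rewrite ge0_integral_distribution//.
  exact: measurableT_comp.
exists (fine \o h); split=> [||A mA].
- exact: measurableT_comp.
- by rewrite EZ.
- have mpA := mpre A mA.
  transitivity (\int[P]_(w in phi @^-1` A) (h \o phi) w)%E.
    by apply: eq_integral => w _ /=; rewrite fineK.
  rewrite -integral_pushforward//; last exact: integrableS iZ.
  exact/esym/(Radon_Nikodym_integral numu mA).
Qed.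

End FactorizedExpectation.

Section ConditionalExpectation.
Context (R : realType) (P : probability (Omega R) R).
Variable G : set (set (Omega R)).
Hypothesis GM : <<s G >> `<=` measurable.
Implicit Types Y Z : Omega R -> R.

Lemma sub_measurable_fun Z : (forall B : set R, measurable B -> <<s G >> (Z @^-1` B)) ->
  measurable_fun setT Z.
Proof. by move=> mZ _ B mB; rewrite setTI; apply: GM; exact: mZ. Qed.

Lemma condexpP Y : P.-integrable setT (EFin \o Y) ->
  is_condexp P <<s G >> Y (condexp P <<s G >> Y).
Proof.
move=> iY; rewrite /condexp; apply: xgetPex.
have mid : measurable_fun setT (idfun : Omega R -> g_sigma_algebraType G).
  by move=> _ B mB; rewrite setTI; exact: (GM mB).
pose phi : {mfun Omega R >-> g_sigma_algebraType G} :=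
  MeasurableFun.Pack (MeasurableFun.Class (isMeasurableFun.Build _ _ _ _ _ mid)).
have [Z [mZ iZ eZ]] := factorized_expectation phi iY.
exists Z; split=> [B mB||A KA]; [|exact: iZ|exact: eZ].
  by have := mZ measurableT B mB; rewrite setTI.
Qed.

(** Integrate the difference over the part of [A] on which the inequality fails:
    that event belongs to the conditioning sigma-field. *)
Lemma condexp_le_on Y Y' Z Z' A : is_condexp P <<s G >> Y Z ->
  is_condexp P <<s G >> Y' Z' ->
  P.-integrable setT (EFin \o Y) -> P.-integrable setT (EFin \o Y') ->
  <<s G >> A -> {ae P, forall w, A w -> Y w <= Y' w} ->
  {ae P, forall w, A w -> Z w <= Z' w}.
Proof.
move=> [KZ iZ eZ] [KZ' iZ' eZ'] iY iY' KA YY'.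
have mZ := sub_measurable_fun KZ; have mZ' := sub_measurable_fun KZ'.
pose B := A `&` [set w | Z' w < Z w].
have KB : <<s G >> B.
  have KI (C D : set (Omega R)) : <<s G >> C -> <<s G >> D -> <<s G >> (C `&` D).
    exact: (@measurableI _ (g_sigma_algebraType G)).
  apply: KI => //.
  have mz : measurable_fun [set: g_sigma_algebraType G] Z.
    by move=> _ D mD; rewrite setTI; exact: KZ.
  have mz' : measurable_fun [set: g_sigma_algebraType G] Z'.
    by move=> _ D mD; rewrite setTI; exact: KZ'.
  have := measurable_fun_ltr mz' mz measurableT (Y := [set true]).
  by rewrite setTI; apply.
have mB := GM KB.
have iS (X : Omega R -> R) : P.-integrable setT (EFin \o X) -> P.-integrable B (EFin \o X).
  by apply: integrableS.
have : {ae P, forall w, B w -> Z' w = Z w}.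
  apply: (le_Rintegral_ae_eq mB (iS _ iZ') (iS _ iZ)); first by move=> w [_ /ltW].
  rewrite /Rintegral eZ// eZ'//; apply: ae_le_Rintegral => //; try exact: iS.
  by apply: ae_mono YY' => w h [Aw _]; exact: h.
apply: ae_mono => w h Aw; rewrite leNgt; apply/negP => lt.
by have := h (conj Aw lt) => e; move: lt; rewrite e ltxx.
Qed.

End ConditionalExpectation.

(** * Essential bounds of directed families *)

Section DirectedFamilies.
Context (R : realType) (P : probability (Omega R) R).
Variable G : set (set (Omega R)).
Hypothesis GM : <<s G >> `<=` measurable.
Local Notation Om := (Omega R).
Local Notation K_measurable :=
  (@measurable_fun _ _ (g_sigma_algebraType G) R setT).
Local Notation Ex X := (\int[P]_w X w).
Implicit Types (X Y Z : Om -> R) (M m : R).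

Lemma K_measurable_measurable X : K_measurable X -> measurable_fun [set: Om] X.
Proof.
by move=> mX _ B mB; have := mX measurableT B mB; rewrite !setTI; exact: GM.
Qed.

Lemma P_bounded_integrable X M : measurable_fun setT X ->
  {ae P, forall w, `|X w| <= M} -> P.-integrable setT (EFin \o X).
Proof.
move=> mX XM; apply/integrableP; split; first exact/measurable_EFinP.
apply: (@le_lt_trans _ _ (\int[P]_(w in [set: Om]) (cst `|M|%:E w))%E).
  apply: ae_ge0_le_integral => //.
  - exact/measurableT_comp/measurable_EFinP.
  - by move=> w _ /=; rewrite lee_fin.
  - apply: ae_mono XM => w h _ /=; rewrite lee_fin.
    exact: le_trans h (ler_norm _).
by rewrite integral_cst//= probability_setT mule1 ltry.
Qed.

(** Dominated convergence, for the lower bound of a sequence of expectations. *)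
Lemma bounded_limit_ge (V : nat -> Om -> R) Z M m :
  (forall n, measurable_fun setT (V n)) -> measurable_fun setT Z ->
  (forall n w, `|V n w| <= M) -> (forall w, V ^~ w @ \oo --> Z w) ->
  (forall n, m <= Ex (V n)) -> m <= Ex Z.
Proof.
move=> mV mZ VM VZ mle.
have mE X : measurable_fun setT X -> measurable_fun setT (EFin \o X).
  by move=> mX; exact/measurable_EFinP.
have [] := @dominated_convergence _ _ R P setT measurableT
  (fun n => EFin \o V n) (EFin \o Z) (cst M%:E) (fun n => mE _ (mV n)) (mE _ mZ).
- by apply: aeW => w _; apply: cvg_comp (VZ w) _; exact: cvg_id.
- exact: finite_measure_integrable_cst.
- by apply: aeW => w n _ /=; rewrite lee_fin.
move=> iZ _ cv.
have fz : (\int[P]_w (Z w)%:E)%E \is a fin_num by exact: integrable_fin_num.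
rewrite -lee_fin /Rintegral fineK//.
apply: (cvge_to_ge cv); apply: nearW => n.
rewrite -[leRHS]fineK ?lee_fin; first exact: mle.
apply: integrable_fin_num => //; apply: (P_bounded_integrable (M := M)) => //.
exact: aeW.
Qed.

(** Members of the families are bounded almost everywhere only; clipping them makes
    the running minima bounded everywhere, so that their limits are plain
    infima of bounded sets of reals. *)
Definition clip M (x : R) : R := Num.max (- M) (Num.min M x).

Lemma clip_id M x : `|x| <= M -> clip M x = x.
Proof.
rewrite ler_norml => /andP[h1 h2].
by rewrite /clip (min_idPr h2) (max_idPr h1).
Qed.

Lemma norm_clip M x : 0 <= M -> `|clip M x| <= M.
Proof.
move=> M0; rewrite /clip ler_norml le_max lexx/= ge_max ge_min lexx/= andbT.
by rewrite (le_trans _ M0)// oppr_le0.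
Qed.

Lemma K_measurable_clip X M : K_measurable X -> K_measurable (clip M \o X).
Proof.
by move=> mX; apply: measurable_maxr => //; apply: measurable_minr.
Qed.

Lemma is_essinf_ae_eq I (S : set I) (Y : I -> Om -> R) Z Z' :
  is_essinf P S Y Z -> is_essinf P S Y Z' -> {ae P, forall w, Z w = Z' w}.
Proof.
move=> [mZ lZ gZ] [mZ' lZ' gZ'].
apply: filterS2 (gZ _ mZ' lZ') (gZ' _ mZ lZ) => w h h'.
by apply/eqP; rewrite eq_le h h'.
Qed.

Section Running.
Variables (M : R) (y : nat -> Om -> R).

Fixpoint running_min n w : R :=
  if n is m.+1 then Num.min (running_min m w) (clip M (y m.+1 w))
  else clip M (y 0%N w).

Hypothesis M0 : 0 <= M.

Lemma running_min_le n w : running_min n w <= clip M (y n w).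
Proof. by case: n => [|n] //=; rewrite ge_min lexx orbT. Qed.

Lemma le_running_min n w z : (forall k, z <= clip M (y k w)) ->
  z <= running_min n w.
Proof. by move=> h; elim: n => [|n IH] /=; [exact: h|rewrite le_min IH h]. Qed.

Lemma norm_running_min n w : `|running_min n w| <= M.
Proof.
rewrite ler_norml le_running_min; last first.
  by move=> k; have := norm_clip (y k w) M0; rewrite ler_norml => /andP[].
apply: le_trans (running_min_le n w) _.
by have := norm_clip (y n w) M0; rewrite ler_norml => /andP[].
Qed.

Definition running_inf w : R := inf (range (running_min ^~ w)).

Lemma has_lbound_running_min w : has_lbound (range (running_min ^~ w)).
Proof.
exists (- M) => _ [n _ <-].
by have := norm_running_min n w; rewrite ler_norml => /andP[].
Qed.

Lemma running_inf_le n w : running_inf w <= running_min n w.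
Proof. by apply: ge_inf; [exact: has_lbound_running_min|exists n]. Qed.

Lemma norm_running_inf w : `|running_inf w| <= M.
Proof.
rewrite ler_norml; apply/andP; split.
  apply: lb_le_inf; first by exists (running_min 0 w), 0%N.
  move=> _ [n _ <-].
  by have := norm_running_min n w; rewrite ler_norml => /andP[].
apply: le_trans (running_inf_le 0 w) _.
by have := norm_running_min 0 w; rewrite ler_norml => /andP[].
Qed.

Lemma cvg_running_min w : running_min ^~ w @ \oo --> running_inf w.
Proof.
apply: nonincreasing_cvgn; last exact: has_lbound_running_min.
by apply/nonincreasing_seqP => n /=; rewrite ge_min lexx.
Qed.

Hypothesis my : forall n, K_measurable (y n).

Lemma K_measurable_running_min n : K_measurable (running_min n).
Proof.
elim: n => [|n IH] /=; first exact: K_measurable_clip.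
by apply: measurable_minr => //; exact: K_measurable_clip.
Qed.

Lemma K_measurable_running_inf : K_measurable running_inf.
Proof.
apply: (@measurable_fun_cvg _ (g_sigma_algebraType G) R setT running_min).
  exact: K_measurable_running_min.
by move=> w _; exact: cvg_running_min.
Qed.

End Running.

Section EssentialInfimum.
Context (I : Type) (S : set I) (Y : I -> Om -> R) (M : R).
Hypotheses (M0 : 0 <= M) (S0 : S !=set0) (mY : forall i, S i -> K_measurable (Y i)).
Hypothesis bY : forall i, S i -> {ae P, forall w, `|Y i w| <= M}.

(** Along a sequence whose expectations tend to the infimum, the running minima
    decrease to a variable with expectation that infimum: directedness forbids
    the minima to have smaller expectation. The same bound for the minimum of this
    variable with any member shows that it is below every member. *)
Lemma essinf_directed :
  (forall i j, S i -> S j -> exists2 k, S k &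
    {ae P, forall w, Y k w <= Num.min (Y i w) (Y j w)}) ->
  exists Z, [/\ is_essinf P S Y Z, K_measurable Z, (forall w, `|Z w| <= M) &
    Ex Z = inf [set Ex (Y i) | i in S]].
Proof.
move=> dirS.
have iY i : S i -> P.-integrable setT (EFin \o Y i).
  move=> Si; apply: (P_bounded_integrable _ (bY Si)).
  exact: K_measurable_measurable (mY Si).
set E := [set Ex (Y i) | i in S]; set m := inf E.
have ExM i : S i -> - M <= Ex (Y i).
  move=> Si; rewrite -[leLHS]mulr1.
  have -> : 1 = fine (P [set: Om]) by rewrite probability_setT.
  rewrite -(Rintegral_cst P measurableT).
  apply: ae_le_Rintegral (iY _ Si) _ => //.
    exact: finite_measure_integrable_cst.
  by apply: ae_mono (bY Si) => w; rewrite ler_norml => /andP[].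
have infE : has_inf E.
  split; first by have [i Si] := S0; exists (Ex (Y i)), i.
  by exists (- M) => _ [i Si <-]; exact: ExM.
have mle i : S i -> m <= Ex (Y i).
  by move=> Si; apply: ge_inf; [case: infE|exists i].
have /choice[j jP] : forall n, exists i, S i /\ Ex (Y i) < m + n.+1%:R^-1.
  move=> n; have n0 : 0 < n.+1%:R^-1 :> R by rewrite invr_gt0.
  by have [_ [i Si <-] h] := inf_adherent n0 infE; exists i.
pose V := running_min M (fun n => Y (j n)); pose Z := running_inf M (fun n => Y (j n)).
have mYj n : K_measurable (Y (j n)) by apply: mY; case: (jP n).
have mV n : measurable_fun setT (V n).
  by apply: K_measurable_measurable; exact: K_measurable_running_min.
have KZ : K_measurable Z by exact: K_measurable_running_inf.
have mZ : measurable_fun setT Z by exact: K_measurable_measurable.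
have bZ w : `|Z w| <= M by exact: norm_running_inf.
have iZ : P.-integrable setT (EFin \o Z).
  by apply: (P_bounded_integrable mZ (M := M)); exact: aeW.
have clipY i : S i -> {ae P, forall w, clip M (Y i w) = Y i w}.
  by move=> Si; apply: ae_mono (bY Si) => w; exact: clip_id.
(* By directedness each running minimum dominates some member. *)
have dirV n : exists2 i, S i & {ae P, forall w, Y i w <= V n w}.
  elim: n => [|n [i Si iV]].
    exists (j 0%N); first by case: (jP 0%N).
    by apply: ae_mono (clipY (j 0%N) _) => [w /= ->//|]; case: (jP 0%N).
  have [Sj _] := jP n.+1; have [k Sk kY] := dirS _ _ Si Sj.
  exists k => //; apply: filterS3 iV kY (clipY _ Sj) => w h1 h2 h3.
  rewrite /V /= h3 le_min; move: h2; rewrite le_min => /andP[h2 ->].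
  by rewrite andbT (le_trans h2).
have mV' i n : S i -> m <= Ex (fun w => Num.min (V n w) (clip M (Y i w))).
  move=> Si; have [l Sl lV] := dirV n; have [k Sk kY] := dirS _ _ Sl Si.
  apply: le_trans (mle _ Sk) _; apply: ae_le_Rintegral => //; first exact: iY.
    apply: (P_bounded_integrable (M := M)).
      apply: measurable_minr => //.
      by apply: K_measurable_measurable; apply: K_measurable_clip; exact: mY.
    apply: aeW => w; have h1 := norm_running_min (fun n => Y (j n)) M0 n w.
    by rewrite /Num.min; case: ifP => // _; exact: norm_clip.
  apply: filterS3 lV kY (clipY _ Si) => w h1 h2 h3 _; rewrite h3 le_min.
  by move: h2; rewrite le_min => /andP[h2 ->]; rewrite andbT (le_trans h2).
have mZi i : S i -> m <= Ex (fun w => Num.min (Z w) (clip M (Y i w))).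
  move=> Si.
  have mc : measurable_fun setT (fun w => clip M (Y i w)).
    by apply: K_measurable_measurable; apply: K_measurable_clip; exact: mY.
  apply: (@bounded_limit_ge (fun n w => Num.min (V n w) (clip M (Y i w))) _ M).
  - by move=> n; apply: measurable_minr.
  - exact: measurable_minr.
  - move=> n w; have h1 := norm_running_min (fun n => Y (j n)) M0 n w.
    by rewrite /Num.min; case: ifP => // _; exact: norm_clip.
  - move=> w; have h1 := @cvg_running_min _ (fun n => Y (j n)) M0 w.
    apply/cvgrPdist_lt => e e0; move/cvgrPdist_lt: h1 => /(_ e e0).
    apply: filterS => n; rewrite -/V -/Z !ltr_norml => /andP[? ?].
    apply/andP; split; rewrite /Order.min;
      case: (ltP (Z w) (clip M (Y i w))) => ?;
      by case: (ltP (V n w) (clip M (Y i w))) => ?; lra.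
  - by move=> n; exact: mV'.
have ZV w n : Z w <= clip M (Y (j n) w).
  exact: le_trans (running_inf_le _ M0 n w) (running_min_le _ _ _ _).
have EZm : Ex Z <= m.
  apply/ler_addgt0Pl => e e0; have [n ne] := ltr_add_invr e0.
  rewrite add0r in ne; have [Sj jm] := jP n.
  rewrite addrC; apply: le_trans (ltW (lt_trans jm _)); last by rewrite ltrD2l.
  apply: ae_le_Rintegral => //; first exact: iY.
  by apply: ae_mono (clipY _ Sj) => w h _; rewrite -h.
(* The minimum of [Z] and a member lies below [Z] and has at least the same
   expectation, hence equals [Z]. *)
have ZY i : S i -> {ae P, forall w, Z w <= Y i w}.
  move=> Si.
  have mc : measurable_fun setT (fun w => clip M (Y i w)).
    by apply: K_measurable_measurable; apply: K_measurable_clip; exact: mY.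
  have : {ae P, forall w, [set: Om] w -> Num.min (Z w) (clip M (Y i w)) = Z w}.
    apply: le_Rintegral_ae_eq => //.
    - apply: (P_bounded_integrable (M := M)); first exact: measurable_minr.
      apply: aeW => w; rewrite /Num.min; case: ifP => // _; exact: norm_clip.
    - by move=> w _; rewrite ge_min lexx.
    - exact: le_trans EZm (mZi i Si).
  apply: filterS2 (clipY i Si) => w h1 h2.
  by rewrite -h1; apply/min_idPl/h2.
exists Z; split=> //; first split=> //.
- move=> Z' mZ' Z'Y.
  have : {ae P, forall w, forall n, Z' w <= clip M (Y (j n) w)}.
    apply: ae_foralln => n; have [Sj _] := jP n.
    by apply: filterS2 (Z'Y _ Sj) (clipY _ Sj) => w h ->.
  apply: ae_mono => w h; apply: lb_le_inf; first by exists (V 0%N w), 0%N.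
  by move=> _ [n _ <-]; exact: le_running_min.
- apply/eqP; rewrite eq_le EZm /=; have [i Si] := S0.
  apply: le_trans (mZi i Si) _; apply: le_Rintegral => //.
    apply: (P_bounded_integrable (M := M)).
      apply: measurable_minr => //.
      by apply: K_measurable_measurable; apply: K_measurable_clip; exact: mY.
    apply: aeW => w; rewrite /Num.min; case: ifP => // _; exact: norm_clip.
  by move=> w _; rewrite ge_min lexx.
Qed.

End EssentialInfimum.

Lemma is_esssup_opp I (S : set I) (Y : I -> Om -> R) Z :
  is_essinf P S (fun i w => - Y i w) (fun w => - Z w) -> is_esssup P S Y Z.
Proof.
move=> [mZ lZ gZ]; split.
- have := measurableT_comp (@oppr_measurable R setT) mZ.
  by congr (measurable_fun _ _); apply/funext => w /=; rewrite opprK.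
- by move=> i Si; apply: ae_mono (lZ i Si) => w; rewrite lerN2.
- move=> Z' mZ' h.
  have mN : measurable_fun setT (fun w => - Z' w).
    exact: (measurableT_comp (@oppr_measurable R setT) mZ').
  have := gZ _ mN; move=> /(_ _)/ae_mono; apply => [w|i Si]; first by rewrite lerN2.
  by apply: ae_mono (h i Si) => w; rewrite lerN2.
Qed.

Lemma is_esssup_ae_eq I (S : set I) (Y : I -> Om -> R) Z Z' :
  is_esssup P S Y Z -> is_esssup P S Y Z' -> {ae P, forall w, Z w = Z' w}.
Proof.
move=> [mZ lZ gZ] [mZ' lZ' gZ'].
apply: filterS2 (gZ _ mZ' lZ') (gZ' _ mZ lZ) => w h h'.
by apply/eqP; rewrite eq_le h h'.
Qed.

Lemma is_esssup_ext I (S : set I) (Y Y' : I -> Om -> R) Z :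
  (forall i, S i -> {ae P, forall w, Y i w = Y' i w}) ->
  is_esssup P S Y Z -> is_esssup P S Y' Z.
Proof.
move=> YY' [mZ lZ gZ]; split=> //.
  by move=> i Si; apply: filterS2 (YY' i Si) (lZ i Si) => w ->.
move=> Z' mZ' h; apply: gZ => // i Si.
by apply: filterS2 (YY' i Si) (h i Si) => w ->.
Qed.

Lemma esssup_directed (I : Type) (S : set I) (Y : I -> Om -> R) M :
  0 <= M -> S !=set0 -> (forall i, S i -> K_measurable (Y i)) ->
  (forall i, S i -> {ae P, forall w, `|Y i w| <= M}) ->
  (forall i j, S i -> S j -> exists2 k, S k &
    {ae P, forall w, Num.max (Y i w) (Y j w) <= Y k w}) ->
  exists Z, [/\ is_esssup P S Y Z, K_measurable Z, (forall w, `|Z w| <= M) &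
    Ex Z = sup [set Ex (Y i) | i in S]].
Proof.
move=> M0 S0 mY bY dirS.
have mN X : K_measurable X -> K_measurable (fun w => - X w).
  move=> mX; exact: (measurableT_comp (@oppr_measurable R setT) mX).
have ExN i : S i -> Ex (fun w => - Y i w) = - Ex (Y i).
  move=> Si; rewrite -mulN1r -RintegralZl//.
    by apply: eq_Rintegral => w _; rewrite mulN1r.
  exact: P_bounded_integrable (K_measurable_measurable (mY i Si)) (bY i Si).
have [|i Si|i j Si Sj|Z [sZ mZ bZ eZ]] :=
    @essinf_directed I S (fun i w => - Y i w) M M0 S0.
- by move=> i Si; apply: mN; exact: mY.
- by apply: ae_mono (bY i Si) => w; rewrite normrN.
- have [k Sk h] := dirS i j Si Sj; exists k => //.
  by apply: ae_mono h => w; rewrite -oppr_max lerN2.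
exists (fun w => - Z w); split.
- by apply: is_esssup_opp; under [X in is_essinf _ _ _ X]eq_fun do rewrite opprK.
- exact: mN.
- by move=> w; rewrite normrN.
- transitivity (- Ex Z); last first.
    rewrite eZ /inf opprK; congr sup; apply/seteqP; split=> y.
      by move=> [_ [i Si <-] <-]; exists i => //; rewrite ExN// opprK.
    by move=> [i Si <-]; exists (- Ex (Y i)); rewrite ?opprK//; exists i; rewrite ?ExN.
  rewrite -mulN1r -RintegralZl//.
    by apply: eq_Rintegral => w _; rewrite mulN1r.
  apply: (P_bounded_integrable (M := M)); first exact: K_measurable_measurable.
  exact: aeW.
Qed.

(** Pasting two indices along the event where one variable is below the other
    shows that the inner families are directed downwards, and likewise that
    their essential infima are directed upwards; hence both essential bounds
    commute with the expectation. The pasted outer index has to serve all inner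
    indices at once, for the comparison passes through every member of the inner
    family. *)
Lemma nested_essential_bounds (I J : Type) (S : set I) (S' : set J)
    (Y : I -> J -> Om -> R) M :
  0 <= M -> S !=set0 -> S' !=set0 ->
  (forall i j, S i -> S' j -> K_measurable (Y i j)) ->
  (forall i j, S i -> S' j -> {ae P, forall w, `|Y i j w| <= M}) ->
  (forall i1 i2 A, S i1 -> S i2 -> <<s G >> A -> exists2 i, S i &
    forall j, S' j -> {ae P, forall w, (A w -> Y i j w = Y i1 j w) /\
                                       (~ A w -> Y i j w = Y i2 j w)}) ->
  (forall i j1 j2 A, S i -> S' j1 -> S' j2 -> <<s G >> A -> exists2 j, S' j &
    {ae P, forall w, (A w -> Y i j w = Y i j1 w) /\
                     (~ A w -> Y i j w = Y i j2 w)}) ->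
  exists (Z : I -> Om -> R) (Q : Om -> R),
    [/\ forall i, S i -> is_essinf P S' (Y i) (Z i), is_esssup P S Z Q,
      K_measurable Q, (forall w, `|Q w| <= M) &
      Ex Q = sup [set inf [set Ex (Y i j) | j in S'] | i in S]].
Proof.
move=> M0 S0 S'0 mY bY pasteI pasteJ.
have Kle X X' : K_measurable X -> K_measurable X' ->
    <<s G >> [set w | X w <= X' w].
  move=> mX mX'; have := measurable_fun_ler mX mX' measurableT (Y := [set true]).
  by rewrite setTI; apply.
have /choice[Z ZP] : forall i, exists Z, S i ->
    [/\ is_essinf P S' (Y i) Z, K_measurable Z, (forall w, `|Z w| <= M) &
      Ex Z = inf [set Ex (Y i j) | j in S']].
  move=> i; have [Si|nSi] := pselect (S i); last by exists (cst 0).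
  have [j Sj|j Sj|j1 j2 Sj1 Sj2|Z ZP] := @essinf_directed J S' (Y i) M M0 S'0.
  - exact: mY.
  - exact: bY.
  - have [j Sj h] := pasteJ i j1 j2 _ Si Sj1 Sj2
      (Kle _ _ (mY _ _ Si Sj1) (mY _ _ Si Sj2)).
    exists j => //; apply: ae_mono h => w /= [h1 h2].
    have [le|gt] := leP (Y i j1 w) (Y i j2 w); first by rewrite h1// lexx.
    by rewrite h2 ?lexx//=; apply/negP; rewrite -ltNge.
  - by exists Z.
have [i Si|i Si|i1 i2 Si1 Si2|Q [sQ mQ bQ eQ]] := @esssup_directed I S Z M M0 S0.
- by have [] := ZP i Si.
- by have [_ _ h _] := ZP i Si; exact: aeW.
- have [sZ1 mZ1 _ _] := ZP _ Si1; have [sZ2 mZ2 _ _] := ZP _ Si2.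
  have [i Si h] := pasteI i1 i2 _ Si1 Si2 (Kle _ _ mZ2 mZ1).
  exists i => //; have [[_ _ gZ] _ _ _] := ZP i Si.
  apply: gZ.
    by apply: K_measurable_measurable; exact: measurable_maxr.
  move=> j Sj; have [_ l1 _] := sZ1; have [_ l2 _] := sZ2.
  apply: filterS3 (h j Sj) (l1 j Sj) (l2 j Sj) => w /= [h1 h2] h3 h4.
  have [le|gt] := leP (Z i2 w) (Z i1 w).
    by rewrite h1.
  by rewrite h2//=; apply/negP; rewrite -ltNge.
exists Z, Q; split=> //; first by move=> i Si; have [] := ZP i Si.
rewrite eQ; congr sup; apply/seteqP; split=> y [i Si <-]; exists i => //.
  by have [_ _ _ ->] := ZP i Si.
by have [_ _ _ ->] := ZP i Si.
Qed.

Lemma essinf_famE I (S : set I) (Y : I -> Om -> R) Z :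
  is_essinf P S Y Z -> {ae P, forall w, Z w = essinf_fam P S Y w}.
Proof.
move=> sZ; apply: (is_essinf_ae_eq sZ).
exact: (@xgetI _ (cst 0) [set Z | is_essinf P S Y Z] Z sZ).
Qed.

Lemma esssup_famE I (S : set I) (Y : I -> Om -> R) Z :
  is_esssup P S Y Z -> {ae P, forall w, Z w = esssup_fam P S Y w}.
Proof.
move=> sZ; apply: (is_esssup_ae_eq sZ).
exact: (@xgetI _ (cst 0) [set Z | is_esssup P S Y Z] Z sZ).
Qed.

Lemma Ex_esssup_fam I (S : set I) (Y : I -> Om -> R) Z :
  is_esssup P S Y Z -> Ex (esssup_fam P S Y) = Ex Z.
Proof.
move=> sZ; have sX : is_esssup P S Y (esssup_fam P S Y).
  exact: (@xgetI _ (cst 0) [set Z | is_esssup P S Y Z] Z sZ).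
have [mX _ _] := sX; have [mZ _ _] := sZ.
congr fine; apply: ae_eq_integral => //; try by apply/measurable_EFinP.
by apply: ae_mono (is_esssup_ae_eq sX sZ) => w /= ->.
Qed.

Lemma Ex_essinf_fam I (S : set I) (Y : I -> Om -> R) Z :
  is_essinf P S Y Z -> Ex (essinf_fam P S Y) = Ex Z.
Proof.
move=> sZ; have sX : is_essinf P S Y (essinf_fam P S Y).
  exact: (@xgetI _ (cst 0) [set Z | is_essinf P S Y Z] Z sZ).
have [mX _ _] := sX; have [mZ _ _] := sZ.
congr fine; apply: ae_eq_integral => //; try by apply/measurable_EFinP.
by apply: ae_mono (is_essinf_ae_eq sX sZ) => w /= ->.
Qed.

Section Nested.
Context (I J : Type) (S : set I) (S' : set J) (Y : I -> J -> Om -> R) (M : R).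
Hypotheses (M0 : 0 <= M) (S0 : S !=set0) (S'0 : S' !=set0).
Hypothesis mY : forall i j, S i -> S' j -> K_measurable (Y i j).
Hypothesis bY : forall i j, S i -> S' j -> {ae P, forall w, `|Y i j w| <= M}.
Hypothesis pasteI : forall i1 i2 A, S i1 -> S i2 -> <<s G >> A ->
  exists2 i, S i & forall j, S' j ->
    {ae P, forall w, (A w -> Y i j w = Y i1 j w) /\ (~ A w -> Y i j w = Y i2 j w)}.
Hypothesis pasteJ : forall j1 j2 A, S' j1 -> S' j2 -> <<s G >> A ->
  exists2 j, S' j & forall i, S i ->
    {ae P, forall w, (A w -> Y i j w = Y i j1 w) /\ (~ A w -> Y i j w = Y i j2 w)}.

Lemma expectation_esssup_essinf :
  Ex (esssup_fam P S (fun i => essinf_fam P S' (Y i))) =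
  sup [set inf [set Ex (Y i j) | j in S'] | i in S].
Proof.
have [|Z [Q [sZ sQ _ _ <-]]] := nested_essential_bounds M0 S0 S'0 mY bY pasteI.
  by move=> i j1 j2 A Si Sj1 Sj2 /(pasteJ Sj1 Sj2)[j Sj h]; exists j => //; exact: h.
apply: Ex_esssup_fam; apply: is_esssup_ext sQ => i Si.
exact: essinf_famE (sZ i Si).
Qed.

(** Exchange the two index sets and pass to the opposite variables. *)
Lemma expectation_essinf_esssup :
  Ex (essinf_fam P S' (fun j => esssup_fam P S (fun i => Y i j))) =
  inf [set sup [set Ex (Y i j) | i in S] | j in S'].
Proof.
have [|||i j1 j2 A Sj1 Si1 Si2|Z [Q [sZ sQ mQ bQ eQ]]] :=
  @nested_essential_bounds J I S' S (fun j i w => - Y i j w) M M0 S'0 S0.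
- move=> j i Sj Si.
  exact: (measurableT_comp (@oppr_measurable R setT) (mY Si Sj)).
- by move=> j i Sj Si; apply: ae_mono (bY Si Sj) => w; rewrite normrN.
- move=> j1 j2 A Sj1 Sj2 /(pasteJ Sj1 Sj2)[j Sj h]; exists j => // i Si.
  by apply: ae_mono (h i Si) => w [h1 h2]; split=> [/h1->|/h2->].
- move=> /(pasteI Si1 Si2)[i' Si h]; exists i' => //.
  by apply: ae_mono (h _ Sj1) => w [h1 h2]; split=> [/h1->|/h2->].
have sN j : S' j -> is_esssup P S (fun i => Y i j) (fun w => - Z j w).
  move=> Sj; apply: is_esssup_opp.
  by under [X in is_essinf _ _ _ X]eq_fun do rewrite opprK; exact: sZ.
have sQ' : is_essinf P S' (fun j => esssup_fam P S (fun i => Y i j)) (fun w => - Q w).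
  have [_ lQ gQ] := sQ; split.
  - apply: K_measurable_measurable.
    exact: (measurableT_comp (@oppr_measurable R setT) mQ).
  - move=> j Sj; apply: filterS2 (lQ j Sj) (esssup_famE (sN j Sj)) => w /= h e.
    by apply: (eq_ind _ (fun x => - Q w <= x) _ _ e); rewrite lerN2.
  - move=> Z' mZ' h.
    have mN : measurable_fun setT (fun w => - Z' w).
      exact: (measurableT_comp (@oppr_measurable R setT) mZ').
    have := gQ _ mN; move=> /(_ _)/ae_mono; apply => [w|j Sj].
      by rewrite lerNr.
    apply: filterS2 (h j Sj) (esssup_famE (sN j Sj)) => w /= {}h e.
    by rewrite lerNr; apply: (eq_ind_r (fun x => Z' w <= x) h e).
have iY i j : S i -> S' j -> P.-integrable setT (EFin \o Y i j).
  move=> Si Sj.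
  exact: P_bounded_integrable (K_measurable_measurable (mY Si Sj)) (bY Si Sj).
have ExN X : P.-integrable setT (EFin \o X) -> Ex (fun w => - X w) = - Ex X.
  move=> iX; rewrite -mulN1r -RintegralZl//.
  by apply: eq_Rintegral => w _; rewrite mulN1r.
rewrite (Ex_essinf_fam sQ') ExN; last first.
  apply: (P_bounded_integrable (M := M)); first exact: K_measurable_measurable.
  exact: aeW.
rewrite eQ /inf; congr (- sup _); apply/seteqP; split=> y.
  move=> [j Sj <-]; exists (sup [set Ex (Y i j) | i in S]); first by exists j.
  congr (- sup _); apply/seteqP; split=> z.
    move=> [i Si <-]; exists (- Ex (Y i j)); rewrite ?opprK//.
    by exists i; rewrite ?ExN//; exact: iY.
  by move=> [_ [i Si <-] <-]; exists i => //; rewrite ExN ?opprK//; exact: iY.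
move=> [_ [j Sj <-] <-]; exists j => //.
congr (- sup _); apply/seteqP; split=> z.
  by move=> [_ [i Si <-] <-]; exists i => //; rewrite ExN ?opprK//; exact: iY.
move=> [i Si <-]; exists (- Ex (Y i j)); rewrite ?opprK//.
by exists i; rewrite ?ExN//; exact: iY.
Qed.

End Nested.

End DirectedFamilies.

(** * Controls *)

Section Controls.
Context (R : realType) (T : R).
Local Notation Om := (Omega R).
Local Notation leb := (@lebesgue_measure R).

Lemma sigF_sub j : sigF j `<=` (measurable : set (set Om)).
Proof.
apply: smallest_sub; first exact: sigma_algebra_measurable.
move=> A [k /= /andP[k0 _] kA].
by apply: sub_sigma_algebra; exists k.
Qed.

Lemma sigF_mono i j : (i <= j)%N -> sigF i `<=` (sigF j : set (set Om)).
Proof.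
move=> ij; apply: sub_smallest2r; first exact: smallest_sigma_algebra.
by move=> A [k /= /andP[k0 ki] kA]; exists k => //=; rewrite k0 (leq_trans ki).
Qed.

Local Notation Fj j := (g_sigma_algebraType
  (@coord_events R [set k | (0 < k <= j)%N])).

Lemma sigF0 j : @sigF R j set0.
Proof. exact: (@measurable0 _ (Fj j)). Qed.

Lemma sigFT j : @sigF R j setT.
Proof. exact: (@measurableT _ (Fj j)). Qed.

Lemma sigFC j A : @sigF R j A -> sigF j (~` A).
Proof. exact: (@measurableC _ (Fj j)). Qed.

Lemma sigFI j A B : @sigF R j A -> sigF j B -> sigF j (A `&` B).
Proof. exact: (@measurableI _ (Fj j)). Qed.

Lemma sigFU j A B : @sigF R j A -> sigF j B -> sigF j (A `|` B).
Proof. exact: (@measurableU _ (Fj j)). Qed.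

Section Partition.
Variables (pi : seq R).
Hypotheses (T0 : 0 < T) (hpi : itv_partition 0 T pi).

Lemma tpt_size : tpt pi (size pi) = T.
Proof. by have [_ /eqP <-] := hpi; rewrite (last_nth 0). Qed.

Lemma tpt_le j k : (j <= k)%N -> (k <= size pi)%N -> tpt pi j <= tpt pi k.
Proof.
move=> jk kn; have [path0 _] := hpi.
have srt : sorted <=%R (0 :: pi) by apply: sub_path path0 => x y /ltW.
by apply: (sorted_leq_nth le_trans lexx 0 srt); rewrite ?inE//= ltnS ?(leq_trans jk).
Qed.

Lemma tpt_leT j : (j <= size pi)%N -> tpt pi j <= T.
Proof. by move=> jn; rewrite -tpt_size tpt_le. Qed.

Lemma size_partition_gt0 : (0 < size pi)%N.
Proof.
have [_] := hpi; case: pi => [|//] /= /eqP h.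
by move: T0; rewrite -h ltxx.
Qed.

Lemma time_index_lt t : t < T -> (time_index pi t < size pi)%N.
Proof.
move=> tT; rewrite /time_index -has_find; apply/hasP; exists T => //.
have [_ /eqP <-] := hpi; have := size_partition_gt0.
by case: pi => [//|r s] _ /=; exact: mem_last.
Qed.

Lemma tpt_time_index t : 0 <= t -> tpt pi (time_index pi t) <= t.
Proof.
move=> t0; rewrite /tpt; case e : (time_index pi t) => [//|k] /=.
have /(before_find 0) : (k < time_index pi t)%N by rewrite e.
by rewrite leNgt => ->.
Qed.

End Partition.

Section ControlOperations.
Context (E : topologicalType).
Implicit Types (u w : process R E) (e : E) (A : set Om).

Definition switch c u u' : process R E :=
  fun s om => if s < c then u s om else u' s om.

Definition const_process e : process R E := fun _ _ => e.

Definition paste A u u' : process R E :=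
  fun s om => if `[< A om >] then u s om else u' s om.

Lemma L0_const (K : set (set Om)) a b e : K set0 -> K setT ->
  L0 K a b (const_process e).
Proof.
move=> K0 KT; split=> [B _|s _ B _].
  have [Be|nBe] := pselect (B e).
    rewrite (_ : [set z | _] = [set z : R * Om | a <= z.1 <= b]).
      exact: measurable_strip.
    by apply/seteqP; split=> z /= [].
  by rewrite (_ : [set z | _] = set0)//; apply/seteqP; split=> z // [_].
have [Be|nBe] := pselect (B e).
  by rewrite (_ : _ @^-1` _ = setT)//; apply/seteqP; split.
by rewrite (_ : _ @^-1` _ = set0)//; apply/seteqP; split.
Qed.

Lemma L0_switch (K : set (set Om)) a b c u u' :
  L0 K a b u -> L0 K a b u' -> L0 K a b (switch c u u').
Proof.
move=> [mu Ku] [mu' Ku']; split=> [B bB|s sab B bB]; last first.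
  by rewrite /switch; case: (s < c); [exact: Ku|exact: Ku'].
have mc : measurable [set z : R * Om | z.1 < c].
  rewrite (_ : [set z | _] = setT `&` fst @^-1` `]-oo, c[%classic).
    exact: (@measurable_fst _ _ R Om measurableT).
  by rewrite setTI; apply/seteqP; split=> z /=; rewrite in_itv.
rewrite (_ : [set z | _] =
    ([set z | a <= z.1 <= b /\ B (u z.1 z.2)] `&` [set z | z.1 < c]) `|`
    ([set z | a <= z.1 <= b /\ B (u' z.1 z.2)] `&` ~` [set z | z.1 < c])).
  apply: measurableU; apply: measurableI => //; [exact: mu|exact: mu'|].
  exact: measurableC.
apply/seteqP; split=> z /=; rewrite /switch.
  by move=> [zab]; case: (boolP (z.1 < c)) => zc Bz; [left|right]; split=> //; exact/negP.
by move=> [[[zab Bz] ->]//|[[zab Bz] /negP/negbTE->]].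
Qed.

Lemma L0_paste a b A u u' : measurable A ->
  L0 measurable a b u -> L0 measurable a b u' -> L0 measurable a b (paste A u u').
Proof.
move=> mA [mu Ku] [mu' Ku']; split=> [B bB|s sab B bB]; last first.
  rewrite (_ : _ @^-1` _ = (A `&` u s @^-1` B) `|` (~` A `&` u' s @^-1` B)).
    apply: measurableU; apply: measurableI => //; [exact: Ku|exact: measurableC|exact: Ku'].
  apply/seteqP; split=> om; rewrite /paste/=; case: asboolP => Aom; try by left.
  - by right.
  - by move=> [[_ //]|[]].
  - by move=> [[]|[_ //]].
have mA2 : measurable [set z : R * Om | A z.2].
  rewrite (_ : [set z | _] = setT `&` snd @^-1` A) ?setTI//.
  by rewrite -[X in measurable X]setTI; exact: measurable_snd.
rewrite (_ : [set z | _] =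
    ([set z | a <= z.1 <= b /\ B (u z.1 z.2)] `&` [set z | A z.2]) `|`
    ([set z | a <= z.1 <= b /\ B (u' z.1 z.2)] `&` ~` [set z | A z.2])).
  apply: measurableU; apply: measurableI => //; [exact: mu|exact: mu'|].
  exact: measurableC.
apply/seteqP; split=> z /=; rewrite /paste.
  by move=> [zab]; case: asboolP => zc Bz; [left|right]; split.
by move=> [[[zab Bz] Az]|[[zab Bz] Az]]; case: asboolP.
Qed.

Variables (K : nat -> set (set Om)) (pi : seq R).
Hypothesis K0 : forall j, K j set0.
Hypothesis KT : forall j, K j setT.
Hypotheses (T0 : 0 < T) (hpi : itv_partition 0 T pi).

Lemma admissible_const e : admissible T K pi (const_process e).
Proof.
split; first exact: L0_const.
move=> j _; exists (fun k => if k is 0%N then setT else set0), (fun=> const_process e).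
split=> //.
- by move=> [|k]; [exact: sigFT|exact: sigF0].
- by move=> [|k] [|l] _ _ //= [om []].
- by apply/seteqP; split=> // om _; exists 0%N.
- by move=> k; exact: L0_const.
Qed.

Lemma admissible_switch c e w : admissible T K pi w ->
  admissible T K pi (switch c (const_process e) w).
Proof.
move=> [Lw dw]; split; first by apply: L0_switch => //; exact: L0_const.
move=> j /dw[Gam [v [h1 h2 h3 h4 h5]]].
exists Gam, (fun k => switch c (const_process e) (v k)); split=> //.
  by move=> k; apply: L0_switch => //; exact: L0_const.
by move=> k s om sj Gk; rewrite /switch; case: ifP => // _; exact: h5.
Qed.

(** Pasting along an event of [sigF i] is compatible with the structure of controls
    from [t_i] on, as the event is then known at the start of each interval;
    before [t_i] the first control is kept. *)
Lemma admissible_paste i A w w' : (i <= size pi)%N -> sigF i A ->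
  admissible T K pi w -> admissible T K pi w' ->
  admissible T K pi (switch (tpt pi i) w (paste A w w')).
Proof.
move=> ni iA [Lw dw] [Lw' dw']; split.
  by apply: L0_switch => //; apply: L0_paste => //; exact: (sigF_sub iA).
move=> j /[dup] /andP[j1 jn] /[dup] /dw[Gam [v [h1 h2 h3 h4 h5]]].
move=> /dw'[Gam' [v' [h1' h2' h3' h4' h5']]].
have [ji|ij] := leqP j i.
  exists Gam, v; split=> // k s om /andP[sj sj'] Gk; rewrite /switch.
  by rewrite (lt_le_trans sj' (tpt_le hpi ji ni)) (h5 k)// sj.
have iA' : sigF j.-1 A by apply: sigF_mono iA; rewrite -ltnS prednK.
(* Even indices carry the pieces of [w] inside [A], odd ones those of [w'] outside. *)
exists (fun k => if odd k then Gam' k./2 `\` A else Gam k./2 `&` A).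
exists (fun k => if odd k then v' k./2 else v k./2); split.
- move=> k; case: ifP => _; last exact: sigFI.
  by apply: sigFI => //; exact: sigFC.
- move=> k l _ _ [om []]; case: ifPn => ok; case: ifPn => ol //.
  + move=> [Gk _] [Gl _]; have e := h2' k./2 l./2 I I (ex_intro _ om (conj Gk Gl)).
    by rewrite -[k]odd_double_half -[l]odd_double_half ok ol e.
  + by move=> [_ nA] [_ /nA].
  + by move=> [_ Aom] [_ /(_ Aom)].
  + move=> [Gk _] [Gl _]; have e := h2 k./2 l./2 I I (ex_intro _ om (conj Gk Gl)).
    by rewrite -[k]odd_double_half -[l]odd_double_half (negbTE ok) (negbTE ol) e.
- apply/seteqP; split=> // om _; have [Aom|nA] := pselect (A om).
    have [k _ Gk] : (\bigcup_k Gam k) om by rewrite h3.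
    by exists k.*2 => //; rewrite odd_double doubleK.
  have [k _ Gk] : (\bigcup_k Gam' k) om by rewrite h3'.
  by exists k.*2.+1 => //=; rewrite odd_double /= uphalf_double.
- by move=> k; case: ifP.
- move=> k s om /[dup] sj /andP[js _].
  have /negbTE nsi : ~~ (s < tpt pi i).
    rewrite -leNgt (le_trans _ js)// tpt_le//; first by rewrite -ltnS prednK.
    exact: leq_trans (leq_pred j) jn.
  rewrite /switch nsi /paste; case: ifP => _ [Gk Aom].
    by rewrite asboolF// (h5' k./2).
  by rewrite asboolT// (h5 k./2).
Qed.

Lemma controls_const t e : controls T K pi t (const_process e).
Proof. by exists (const_process e) => //; exact: admissible_const. Qed.

Lemma controls_widen t t' u : t <= t' ->
  controls T K pi t u -> controls T K pi t' u.
Proof.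
move=> tt' [w aw uw]; exists w => // s om /andP[ts sT].
by apply: uw; rewrite (le_trans tt').
Qed.

Lemma controls_switch t t' e u : controls T K pi t' u ->
  controls T K pi t (switch t' (const_process e) u).
Proof.
move=> [w aw uw]; exists (switch t' (const_process e) w).
  exact: admissible_switch.
move=> s om /andP[ts sT]; rewrite /switch; case: ltP => // st.
by rewrite uw// st.
Qed.

Lemma controls_paste t i A u u' : (i <= size pi)%N -> tpt pi i <= t -> sigF i A ->
  controls T K pi t u -> controls T K pi t u' ->
  controls T K pi t (paste A u u').
Proof.
move=> ni it iA [w aw uw] [w' aw' uw'].
exists (switch (tpt pi i) w (paste A w w')); first exact: admissible_paste.
move=> s om /[dup] tsT /andP[ts _].
by rewrite /switch ltNge (le_trans it ts)/= /paste uw// uw'.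
Qed.

End ControlOperations.

End Controls.

(** * Strategies and couples *)

Section Strategies.
Context (R : realType) (T : R) (P : probability (Omega R) R).
Local Notation Om := (Omega R).
Local Notation leb := (@lebesgue_measure R).

Lemma ae_neq_time (t : R) :
  {ae (leb \x P)%E, forall z : R * Om, z.1 != t}.
Proof.
exists ([set t] `*` setT); split.
- exact: measurableX.
- by rewrite product_measure1E//= lebesgue_measure_set1 mul0e.
- by move=> z /= /negP; rewrite negbK => /eqP.
Qed.

Section Upto.
Context (E : Type).
Implicit Types u : process R E.

Lemma ae_eq_upto_le t t' (theta theta' : Om -> R) u u' : t <= t' ->
  (forall om, theta' om <= theta om) ->
  ae_eq_upto P t theta u u' -> ae_eq_upto P t' theta' u u'.
Proof.
move=> tt' th; apply: ae_mono => z h /andP[tz zt]; apply: h.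
by rewrite (le_trans tt')//= (le_trans zt).
Qed.

Lemma ae_eq_upto_trans t theta u1 u2 u3 :
  ae_eq_upto P t theta u1 u2 -> ae_eq_upto P t theta u2 u3 ->
  ae_eq_upto P t theta u1 u3.
Proof. by apply: ae_mono2 => z h1 h2 h; rewrite h1// h2. Qed.

(** Only the single time [t] can be concerned, and it is a null set. *)
Lemma ae_eq_upto_start t u u' c : c <= t -> ae_eq_upto P t (cst c) u u'.
Proof.
move=> ct; apply: ae_mono (ae_neq_time t) => z /eqP zt /andP[tz zc].
by exfalso; apply: zt; apply/le_anti; rewrite tz (le_trans zc).
Qed.

End Upto.

Variable pi : seq R.
Hypotheses (T0 : 0 < T) (hpi : itv_partition 0 T pi).

Lemma stopping_time_const i : stopping_time (fun _ : Om => i).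
Proof.
move=> j; have [->|ij] := eqVneq i j.
  by rewrite (_ : [set _ | _] = setT); [exact: sigFT|apply/seteqP].
rewrite (_ : [set _ | _] = set0); first exact: sigF0.
by apply/seteqP; split=> // om /= e; move: ij; rewrite e eqxx.
Qed.

Lemma stopping_time_split i l A : (i <= l)%N -> sigF i A ->
  stopping_time (fun om : Om => if `[< A om >] then l else i).
Proof.
move=> il iA j.
rewrite (_ : [set _ | _] = (if l == j then A else set0) `|`
    (if i == j then ~` A else set0)).
  apply: sigFU; case: eqP => [<-|_]; try exact: sigF0.
    exact: sigF_mono iA.
  exact: sigFC.
apply/seteqP; split=> om /=; case: asboolP => Aom.
- by move=> <-; rewrite eqxx; left.
- by move=> <-; rewrite eqxx; right.
- by case=> [|]; case: eqP => // _ [].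
- by case=> [|]; case: eqP => // _ [].
Qed.

Section OnePlayer.
Context (E E' : topologicalType) (K K' : nat -> set (set Om)).
Hypothesis K'0 : forall j, K' j set0.
Hypothesis K'T : forall j, K' j setT.
Hypothesis K0 : forall j, K j set0.
Hypothesis KT : forall j, K j setT.
Implicit Types (beta : process R E -> process R E') (u : process R E).

Lemma NAD_const t e :
  NAD T P K K' pi t (fun _ : process R E => const_process e : process R E').
Proof.
split=> [u _|u u' _ _ _ s om _ //|tau _ _ u u' _ _ _].
  exact: controls_const.
exact: aeW.
Qed.

Lemma NAD_paste t i A beta beta' : (i <= size pi)%N -> tpt pi i <= t -> sigF i A ->
  NAD T P K K' pi t beta -> NAD T P K K' pi t beta' ->
  NAD T P K K' pi t (fun u => paste A (beta u) (beta' u)).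
Proof.
move=> ni it iA [c1 e1 n1] [c2 e2 n2]; split.
- move=> u cu; apply: (controls_paste hpi ni it iA); [exact: c1|exact: c2].
- move=> u u' cu cu' uu' s om sT; rewrite /paste.
  by rewrite (e1 _ _ cu cu' uu')// (e2 _ _ cu cu' uu').
- move=> tau st tn u u' cu cu' uu'.
  apply: ae_mono2 (n1 _ st tn _ _ cu cu' uu') (n2 _ st tn _ _ cu cu' uu').
  by move=> z h1 h2 h; rewrite /paste h1// h2.
Qed.

(** The constant played before [t'] does not depend on the opponent, so that
    nothing is anticipated. *)
Lemma NAD_extend t t' e beta : t <= t' -> NAD T P K K' pi t' beta ->
  NAD T P K K' pi t (fun u => switch t' (const_process e) (beta u)).
Proof.
move=> tt' [c1 e1 n1]; have cw := controls_widen tt'; split.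
- by move=> u cu; apply: controls_switch => //; apply: c1; exact: cw.
- move=> u u' cu cu' uu' s om /andP[ts sT]; rewrite /switch; case: ltP => // t's.
  apply: e1; [exact: cw|exact: cw| |by rewrite t's].
  by move=> r om' /andP[t'r rT]; apply: uu'; rewrite (le_trans tt').
- move=> tau st tn u u' cu cu' uu'.
  have := n1 _ st tn _ _ (cw _ _ _ _ _ cu) (cw _ _ _ _ _ cu')
    (ae_eq_upto_le tt' (fun om => lexx _) uu').
  apply: ae_mono => z h /andP[tz zt]; rewrite /switch; case: ltP => // t'z.
  by apply: h; rewrite t'z.
Qed.

(** Two controls that agree from [t'] on still agree once both are preceded by the
    same constant. *)
Lemma NAD_restrict t t' e beta : t <= t' -> NAD T P K K' pi t beta ->
  NAD T P K K' pi t' (fun u => beta (switch t' (const_process e) u)).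
Proof.
move=> tt' [c1 e1 n1]; have cw := controls_widen tt'.
have cs := @controls_switch _ _ _ _ _ K0 KT t t' e; split.
- by move=> u cu; apply: cw; apply: c1; exact: cs.
- move=> u u' cu cu' uu' s om /andP[ts sT].
  apply: e1; [exact: cs|exact: cs| |by rewrite (le_trans tt')].
  move=> r om' /andP[tr rT]; rewrite /switch; case: ltP => // t'r.
  by apply: uu'; rewrite t'r.
- move=> tau st tn u u' cu cu' uu'.
  apply: (ae_eq_upto_le tt' (fun om => lexx _)).
  apply: n1 => //; [exact: cs|exact: cs|].
  apply: ae_mono uu' => z h /andP[tz zt]; rewrite /switch; case: ltP => // t'z.
  by apply: h; rewrite t'z.
Qed.

Lemma NAD_upto_const t beta u u' l : NAD T P K K' pi t beta -> (l < size pi)%N ->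
  controls T K pi t u -> controls T K pi t u' ->
  ae_eq_upto P t (cst (tpt pi l)) u u' ->
  ae_eq_upto P t (cst (tpt pi l.+1)) (beta u) (beta u').
Proof.
by move=> [_ _ n1] ln cu cu'; apply: (n1 _ (stopping_time_const l)).
Qed.

(** The weaker form of nonanticipation, where the interval gained is given up
    again; it also covers the horizon [l = size pi], at which no stopping time
    may take its value. *)
Lemma NAD_upto_same t beta u u' l : NAD T P K K' pi t beta -> (0 < l <= size pi)%N ->
  controls T K pi t u -> controls T K pi t u' ->
  ae_eq_upto P t (cst (tpt pi l)) u u' ->
  ae_eq_upto P t (cst (tpt pi l)) (beta u) (beta u').
Proof.
case: l => // l nb /= ln cu cu' uu'; apply: NAD_upto_const => //.
by apply: ae_eq_upto_le uu' => // om; rewrite (tpt_le hpi)// ltnW.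
Qed.

(** On an event known at time [t_i], agreement up to [t_l] propagates up to
    [t_(l+1)]: stop at [l] on the event and already at [i] off it. *)
Lemma NAD_upto_event t beta u u' i l A : NAD T P K K' pi t beta ->
  (i <= l < size pi)%N -> tpt pi i <= t -> sigF i A ->
  controls T K pi t u -> controls T K pi t u' ->
  {ae (leb \x P)%E, forall z, t <= z.1 <= tpt pi l -> A z.2 -> u z.1 z.2 = u' z.1 z.2} ->
  {ae (leb \x P)%E, forall z, t <= z.1 <= tpt pi l.+1 -> A z.2 ->
    beta u z.1 z.2 = beta u' z.1 z.2}.
Proof.
move=> [_ _ nb] /andP[il ln] it iA cu cu' uu'.
have tau_lt om : ((if `[< A om >] then l else i) < size pi)%N.
  by case: ifP => // _; exact: leq_ltn_trans ln.
have := nb _ (stopping_time_split il iA) tau_lt u u' cu cu'.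
move=> /(_ _)/ae_mono; apply => [z h tz Az|].
  by apply: h; rewrite asboolT.
apply: ae_mono2 uu' (ae_eq_upto_start u u' it) => z h1 h2 /=.
by case: asboolP => Az tz; [exact: h1|exact: h2].
Qed.

End OnePlayer.

Section TwoPlayers.
Context (U V : metricType R).
Local Notation KG := (@sigG R).
Local Notation KH := (@sigH R).
Implicit Types (alpha : process R V -> process R U) (beta : process R U -> process R V).

Lemma sigG0 j : KG j set0.
Proof. by exists set0; [exact: measurable0|rewrite preimage_set0 setI0]. Qed.
Lemma sigGT j : KG j setT.
Proof. by exists setT; [exact: measurableT|rewrite preimage_setT setIT]. Qed.
Lemma sigH0 j : KH j set0.
Proof. by exists set0; [exact: measurable0|rewrite preimage_set0 setI0]. Qed.
Lemma sigHT j : KH j setT.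
Proof. by exists setT; [exact: measurableT|rewrite preimage_setT setIT]. Qed.

(** Both players' controls agree on [A] up to [t_l]; each strategy then gains one
    interval for its own control from the agreement of the opponent's, and so the
    agreement spreads to the horizon, starting from [t_i <= t] where it is void. *)
Lemma couples_agree t i A alpha alpha' beta beta' u v u' v' :
  (i <= size pi)%N -> tpt pi i <= t -> sigF i A ->
  stratA T P pi t alpha' -> stratB T P pi t beta' ->
  (forall v s om, A om -> alpha v s om = alpha' v s om) ->
  (forall u s om, A om -> beta u s om = beta' u s om) ->
  is_couple T P pi t alpha beta u v -> is_couple T P pi t alpha' beta' u' v' ->
  {ae (leb \x P)%E, forall z, t <= z.1 <= T -> A z.2 ->
    u z.1 z.2 = u' z.1 z.2 /\ v z.1 z.2 = v' z.1 z.2}.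
Proof.
move=> ni it iA sa sb aa' bb' [cu cv au bv] [cu' cv' au' bv'].
suff H l : (i <= l <= size pi)%N ->
    {ae (leb \x P)%E, forall z, t <= z.1 <= tpt pi l -> A z.2 ->
      u z.1 z.2 = u' z.1 z.2} /\
    {ae (leb \x P)%E, forall z, t <= z.1 <= tpt pi l -> A z.2 ->
      v z.1 z.2 = v' z.1 z.2}.
  have [|H1 H2] := H (size pi); first by rewrite ni leqnn.
  rewrite (tpt_size hpi) in H1 H2.
  by apply: ae_mono2 H1 H2 => z h1 h2 tz Az; rewrite h1// h2.
elim: l => [|l IH].
  rewrite leqn0 => /andP[/eqP i0 _]; rewrite i0 in it.
  by split; [apply: ae_mono (ae_eq_upto_start u u' it)|
    apply: ae_mono (ae_eq_upto_start v v' it)] => z h tz _; exact: h.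
rewrite leq_eqVlt => /andP[/predU1P[il _|il ln]].
  rewrite il in it.
  by split; [apply: ae_mono (ae_eq_upto_start u u' it)|
    apply: ae_mono (ae_eq_upto_start v v' it)] => z h tz _; exact: h.
rewrite ltnS in il; have [|IHu IHv] := IH; first by rewrite il ltnW.
have iln : (i <= l < size pi)%N by rewrite il.
have zT (z : R * Om) : t <= z.1 <= tpt pi l.+1 -> t <= z.1 <= T.
  by move=> /andP[-> /le_trans]; apply; exact: tpt_leT hpi _ ln.
split.
- have := NAD_upto_event sa iln it iA cv cv' IHv.
  move=> h; apply: ae_mono3 h au au' => z h1 h2 h3 tz Az.
  by rewrite -h2 ?aa' ?h1 ?h3 ?zT.
- have := NAD_upto_event sb iln it iA cu cu' IHu.
  move=> h; apply: ae_mono3 h bv bv' => z h1 h2 h3 tz Az.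
  by rewrite -h2 ?bb' ?h1 ?h3 ?zT.
Qed.

(** Iterating the two strategies alternately stabilizes one more interval of
    the partition at each round. *)
Lemma couple_exists t alpha beta i (v0 : V) : (i <= size pi)%N -> tpt pi i <= t ->
  stratA T P pi t alpha -> stratB T P pi t beta ->
  exists u v, is_couple T P pi t alpha beta u v.
Proof.
move=> ni it sa sb; have [ca _ _] := sa; have [cb _ _] := sb.
pose w := fix w n := if n is m.+1 then beta (alpha (w m)) else const_process v0.
have cw n : controls T KH pi t (w n).
  elim: n => [|n IH] /=; first exact: (controls_const _ _ sigH0 sigHT).
  by apply: cb; exact: ca.
suff H l : (i <= l <= size pi)%N ->
    exists m, ae_eq_upto P t (cst (tpt pi l)) (w m.+1) (w m).
  have [|m wm] := H (size pi); first by rewrite ni leqnn.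
  have n0 : (0 < size pi <= size pi)%N by rewrite (size_partition_gt0 T0 hpi) leqnn.
  exists (alpha (w m)), (w m.+1); split=> //; first exact: ca.
    by rewrite -(tpt_size hpi); exact: (NAD_upto_same sa n0).
  exact: aeW.
elim: l => [|l IH].
  rewrite leqn0 => /andP[/eqP i0 _]; exists 0%N; apply: ae_eq_upto_start.
  by rewrite -i0.
rewrite leq_eqVlt => /andP[/predU1P[il _|il ln]].
  by exists 0%N; apply: ae_eq_upto_start; rewrite -il.
rewrite ltnS in il; have [|m wm] := IH; first by rewrite il ltnW.
exists m.+1 => /=.
have cam k : controls T KG pi t (alpha (w k)) by exact: ca.
apply: (NAD_upto_same sb _ (cam m.+1) (cam m)); first by rewrite /= ln.
exact: NAD_upto_const sa ln (cw m.+1) (cw m) wm.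
Qed.

End TwoPlayers.

End Strategies.

(** * Payoffs along couples of controls *)

(** By Tonelli the measures of the sections of a null set integrate to zero. *)
Lemma ae_sections (R : realType) d (W : measurableType d) (P : probability W R)
    (Q : R * W -> Prop) :
  {ae (@lebesgue_measure R \x P)%E, forall z, Q z} ->
  {ae P, forall w, {ae @lebesgue_measure R, forall r, Q (r, w)}}.
Proof.
move=> [N [mN N0 sub]].
have mI : measurable_fun setT (fun z : measurableTypeR R * W => (\1_N z)%:E : \bar R).
  by apply/measurable_EFinP; exact: measurable_indic.
have eqI w : (\int[@lebesgue_measure R]_r (\1_N (r, w))%:E)%E =
    lebesgue_measure (ysection N w).
  rewrite -[X in _ = lebesgue_measure X]setIT -integral_indic//; last first.
    exact: measurable_ysection.
  by apply: eq_integral => r _; rewrite !indicE mem_ysection.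
have : (\int[P]_w (\int[@lebesgue_measure R]_r (\1_N (r, w))%:E) = 0)%E.
  have f0 (z : measurableTypeR R * W) : (0 <= (\1_N z)%:E :> \bar R)%E.
    by rewrite lee_fin.
  have <- := fubini_tonelli2 (m1 := @lebesgue_measure R) (m2 := P) _ mI f0.
  by rewrite integral_indic// setIT.
under eq_integral do rewrite eqI.
have mY : measurable_fun setT (fun w => lebesgue_measure (ysection N w)).
  exact: (measurable_fun_ysection (@lebesgue_measure R) mN).
move=> e0; have : (\int[P]_w `|lebesgue_measure (ysection N w)| = 0)%E.
  by rewrite -[RHS]e0; apply: eq_integral => w _; rewrite gee0_abs.
move=> /(ae_eq_integral_abs P measurableT mY); apply: ae_mono => w /= /(_ I) Nw0.
exists (ysection N w); split=> //; first exact: measurable_ysection.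
by move=> r nQ; rewrite /ysection/=; apply/mem_set; exact: (sub (r, w)).
Qed.

Lemma metric_ball_open (R : realType) (U : metricType R) (c : U) (e : R) :
  open (ball c e).
Proof.
rewrite openE => y cy; apply/nbhs_ballP.
rewrite ballEmdist/= in cy.
exists (e - mdist c y) => /=; first by rewrite subr_gt0.
move=> z; rewrite !ballEmdist/= => yz.
apply: le_lt_trans (metric_triangle c y z) _; lra.
Qed.

Lemma lipschitz_continuous (R : realType) d (g : 'rV[R]_d -> R) (L : R) :
  (forall x x', `|g x - g x'| <= L * enorm (x - x')) -> continuous g.
Proof.
move=> gL y A /nbhs_ballP[e /= e0 eA]; apply/nbhs_ballP.
have c0 : 0 < `|L| * d%:R + 1 by rewrite ltr_wpDl ?mulr_ge0.
(* The Euclidean norm is at most [d] times the sup norm; the summand 1 only keeps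
   the denominator positive. *)
exists (e / (`|L| * d%:R + 1)) => /=; first by rewrite divr_gt0.
move=> y' [_ yy']; apply: eA; rewrite /ball/=.
apply: le_lt_trans (gL _ _) _.
apply: (@le_lt_trans _ _ (`|L| * (d%:R * (e / (`|L| * d%:R + 1))))).
  apply: le_trans (ler_wpM2r (enorm_ge0 _) (ler_norm L)) _.
  rewrite ler_wpM2l//; apply: le_trans (ler_enorm_sum _) _.
  have -> c : d%:R * c = \sum_(k < d) c.
    by rewrite sumr_const card_ord mulr_natl.
  by apply: ler_sum => k _; rewrite !mxE; apply/ltW/(yy' 0 k).
rewrite !mulrA ltr_pdivrMr// [ltLHS]mulrC ltr_pM2l//.
by rewrite ltrDl.
Qed.

Lemma condexp_eq_on (R : realType) (P : probability (Omega R) R) (G : set (set (Omega R)))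
    (Y Y' Z Z' : Omega R -> R) (A : set (Omega R)) : <<s G >> `<=` measurable ->
  is_condexp P <<s G >> Y Z -> is_condexp P <<s G >> Y' Z' ->
  P.-integrable setT (EFin \o Y) -> P.-integrable setT (EFin \o Y') ->
  <<s G >> A -> {ae P, forall w, A w -> Y w = Y' w} ->
  {ae P, forall w, A w -> Z w = Z' w}.
Proof.
move=> GM cZ cZ' iY iY' KA YY'.
have le : {ae P, forall w, A w -> Z w <= Z' w}.
  apply: (condexp_le_on GM cZ cZ' iY iY' KA).
  by apply: ae_mono YY' => w h /h ->.
have ge : {ae P, forall w, A w -> Z' w <= Z w}.
  apply: (condexp_le_on GM cZ' cZ iY' iY KA).
  by apply: ae_mono YY' => w h /h ->.
by apply: ae_mono2 le ge => w h1 h2 Aw; apply/le_anti; rewrite h1// h2.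
Qed.

Lemma is_condexp_cst (R : realType) (P : probability (Omega R) R) (G : set (set (Omega R)))
    (c : R) : is_condexp P <<s G >> (cst c) (cst c).
Proof.
split=> // [B _|]; last exact: finite_measure_integrable_cst.
have [Bc|nBc] := pselect (B c).
  rewrite (_ : _ @^-1` _ = setT); last by apply/seteqP; split.
  exact: (@measurableT _ (g_sigma_algebraType G)).
rewrite (_ : _ @^-1` _ = set0); last by apply/seteqP; split.
exact: (@measurable0 _ (g_sigma_algebraType G)).
Qed.

Section NestedBounds.
Context (R : realType) (I J I' J' : Type).
Context (S : set I) (S2 : set J) (S' : set I') (S2' : set J').
Context (a : I -> J -> R) (b : I' -> J' -> R) (M c : R).
Hypotheses (S0 : S !=set0) (S2'0 : S2' !=set0).
Hypothesis aM : forall i j, S i -> S2 j -> `|a i j| <= M.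
Hypothesis bM : forall i j, S' i -> S2' j -> `|b i j| <= M.

(** Comparison of two games by translating strategies: the maximizing player's
    from the first game to the second, the minimizing player's replies back. *)
Lemma sup_inf_le :
  (forall i, S i -> exists2 i', S' i' & forall j', S2' j' ->
    exists2 j, S2 j & a i j <= b i' j' + c) ->
  sup [set inf [set a i j | j in S2] | i in S] <=
  sup [set inf [set b i j | j in S2'] | i in S'] + c.
Proof.
move=> h; apply: ge_sup.
  by have [i Si] := S0; exists (inf [set a i j | j in S2]), i.
move=> _ [i Si <-]; have [i' Si' {}h] := h i Si.
rewrite -lerBlDr; apply: (@le_trans _ _ (inf [set b i' j | j in S2'])).
  apply: lb_le_inf; first by have [j Sj] := S2'0; exists (b i' j), j.
  move=> _ [j' Sj' <-]; have [j Sj aj] := h j' Sj'.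
  rewrite lerBlDr; apply: le_trans aj; apply: ge_inf; last by exists j.
  by exists (- M) => _ [k Sk <-]; have := aM Si Sk; rewrite ler_norml => /andP[].
apply: ub_le_sup; last by exists i'.
exists M => _ [k Sk <-]; have [j Sj] := S2'0.
apply: (@le_trans _ _ (b k j)); last first.
  by have := bM Sk Sj; rewrite ler_norml => /andP[].
apply: ge_inf; last by exists j.
by exists (- M) => _ [l Sl <-]; have := bM Sk Sl; rewrite ler_norml => /andP[].
Qed.

Lemma inf_sup_le :
  (forall j', S2' j' -> exists2 j, S2 j & forall i, S i ->
    exists2 i', S' i' & a i j <= b i' j' + c) ->
  inf [set sup [set a i j | i in S] | j in S2] <=
  inf [set sup [set b i j | i in S'] | j in S2'] + c.
Proof.
move=> h; rewrite -lerBlDr; apply: lb_le_inf.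
  by have [j Sj] := S2'0; exists (sup [set b i j | i in S']), j.
move=> _ [j' Sj' <-]; have [j Sj {}h] := h j' Sj'; rewrite lerBlDr.
apply: (@le_trans _ _ (sup [set a i j | i in S])).
  apply: ge_inf; last by exists j.
  exists (- M) => _ [k Sk <-]; have [i Si] := S0.
  apply: (@le_trans _ _ (a i k)).
    by have := aM Si Sk; rewrite ler_norml => /andP[].
  apply: ub_le_sup; last by exists i.
  by exists M => _ [l Sl <-]; have := aM Sl Sk; rewrite ler_norml => /andP[].
apply: ge_sup; first by have [i Si] := S0; exists (a i j), i.
move=> _ [i Si <-]; have [i' Si' ab] := h i Si.
apply: (le_trans ab); rewrite lerD2r; apply: ub_le_sup; last by exists i'.
by exists M => _ [l Sl <-]; have := bM Sl Sj'; rewrite ler_norml => /andP[].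
Qed.

End NestedBounds.

Section Payoffs.
Context (R : realType) (T Cf Lf Lg M : R) (T0 : 0 < T).
Context (d : nat) (U V : metricType R).
Context (f : R -> 'rV[R]_d -> U -> V -> 'rV[R]_d) (g : 'rV[R]_d -> R).
Context (P : probability (Omega R) R).
Hypotheses (cU : compact [set: U]) (U0 : [set: U] !=set0).
Hypotheses (cV : compact [set: V]) (V0 : [set: V] !=set0).
Hypothesis f_cont :
  {within [set z : R * 'rV[R]_d * U * V | 0 <= z.1.1.1 <= T],
    continuous (fun z : R * 'rV[R]_d * U * V => f z.1.1.1 z.1.1.2 z.1.2 z.2)}.
Hypothesis f_bounded : forall t x u v, 0 <= t <= T -> enorm (f t x u v) <= Cf.
Hypothesis f_lipschitz : forall t x x' u v, 0 <= t <= T ->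
  enorm (f t x u v - f t x' u v) <= Lf * enorm (x - x').
Hypothesis g_bounded : forall x, `|g x| <= M.
Hypothesis g_lipschitz : forall x x', `|g x - g x'| <= Lg * enorm (x - x').
Local Notation Om := (Omega R).
Local Notation leb := (@lebesgue_measure R).
Local Notation KG := (@sigG R).
Local Notation KH := (@sigH R).
Implicit Types (u : process R U) (v : process R V) (x : 'rV[R]_d).

(* A positive Lipschitz constant, as the weight [expR (2 * K * s)] requires. *)
Let K : R := `|Lf| + 1.

Lemma lipschitz_gt0 : 0 < K. Proof. by rewrite ltr_wpDl. Qed.

Definition controlled_field u v (om : Om) (r : R) (y : 'rV[R]_d) : 'rV[R]_d :=
  f r y (u r om) (v r om).

Section ControlledEquation.
Variables (pi : seq R) (t : R).
Hypotheses (t0 : 0 <= t) (tT : t <= T).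
Let D : set (R * Om) := [set z | t <= z.1 <= T].

Lemma controls_ball_measurable (E : metricType R) (KE : nat -> set (set Om))
    (u : process R E) : controls T KE pi t u ->
  ball_measurable D (fun z => u z.1 z.2).
Proof.
move=> [w [[mw _] _] uw] c e e0.
have bB : borel (ball c e) by apply: sub_sigma_algebra; exact: metric_ball_open.
have := measurableI _ _ (measurable_strip t T) (mw _ bB); congr measurable.
apply/seteqP; split=> z /=.
  by move=> [zt [_ B]]; split=> //; rewrite uw.
move=> [zt B]; split=> //; split; last by rewrite -uw.
by move: zt => /andP[h ->]; rewrite (le_trans t0 h).
Qed.

Lemma controlled_field_measurable u v (Y : R * Om -> 'rV[R]_d) :
  controls T KG pi t u -> controls T KH pi t v ->
  (forall k, measurable_fun D (fun z => Y z 0 k)) ->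
  forall k, measurable_fun D (fun z => controlled_field u v z.2 z.1 (Y z) 0 k).
Proof.
move=> cu cv mY k; have [u0 _] := U0; have [v0 _] := V0.
have [a da] := compact_dense_family u0 cU; have [b db] := compact_dense_family v0 cV.
have mD : measurable D by exact: measurable_strip.
apply: (measurable_comp_within mD (dense_family_pair (dense_family_pair
    (dense_family_pair (@dense_family_real R) (@dense_family_row R d)) da) db)
  (A := [set z : R * 'rV[R]_d * U * V | 0 <= z.1.1.1 <= T])
  (h := fun z : R * 'rV[R]_d * U * V => f z.1.1.1 z.1.1.2 z.1.2 z.2 0 k)
  (y := fun z : R * Om => (z.1, Y z, u z.1 z.2, v z.1 z.2))).
- apply/subspace_continuousP => z zA.
  have /subspace_continuousP/(_ z zA) fz := f_cont.
  exact: (cvg_comp _ _ fz (@coord_continuous _ _ _ 0 k _)).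
- by move=> z /andP[tz zT] /=; rewrite (le_trans t0 tz).
- apply: ball_measurable_pair; last exact: controls_ball_measurable cv.
  apply: ball_measurable_pair; last exact: controls_ball_measurable cu.
  apply: ball_measurable_pair; last exact: ball_measurable_row.
  apply: ball_measurable_real => //; apply: measurable_funTS.
  exact: measurable_fst.
Qed.

Lemma controlled_field_regular u v om :
  controls T KG pi t u -> controls T KH pi t v ->
  regular_field t T K Cf (controlled_field u v om).
Proof.
move=> cu cv.
have h r : t <= r <= T -> 0 <= r <= T by move=> /andP[/(le_trans t0) -> ->].
apply: (@regular_field_section _ _ _ _ _ _ _ _ (fun om => controlled_field u v om)).
- by move=> w r y /h; exact: f_bounded.
- move=> w r y y' /h rT; apply: le_trans (f_lipschitz _ _ _ _ rT) _.
  by rewrite ler_wpM2r ?enorm_ge0// (le_trans (ler_norm _))// lerDl.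
- by move=> Y mY k; exact: controlled_field_measurable.
Qed.

Lemma controlled_solution u v x :
  controls T KG pi t u -> controls T KH pi t v ->
  exists X : R * Om -> 'rV[R]_d,
    (forall om, solves t T (controlled_field u v om) x (fun s => X (s, om))) /\
    forall k, measurable_fun setT (fun om => X (T, om) 0 k).
Proof.
move=> cu cv.
have h r : t <= r <= T -> 0 <= r <= T by move=> /andP[/(le_trans t0) -> ->].
apply: (@exists_measurable_solution _ _ t T K Cf tT lipschitz_gt0 _ _
  (fun om => controlled_field u v om)).
- by move=> w r y /h; exact: f_bounded.
- move=> w r y y' /h rT; apply: le_trans (f_lipschitz _ _ _ _ rT) _.
  by rewrite ler_wpM2r ?enorm_ge0// (le_trans (ler_norm _))// lerDl.
- by move=> Y mY k; exact: controlled_field_measurable.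
Qed.

(** A trajectory exists, so that the chosen one is not the default value. *)
Lemma traj_solves u v x om :
  controls T KG pi t u -> controls T KH pi t v ->
  solves t T (controlled_field u v om) x (traj T f t x u v om).
Proof.
move=> cu cv; have [X [sX _]] := controlled_solution x cu cv.
exact: (@xgetI _ (cst 0) [set X | is_trajectory T f t x
  (fun s => u s om) (fun s => v s om) X] _ (sX om)).
Qed.

End ControlledEquation.

Lemma traj_compare pi t t' u v u' v' x x' om : 0 <= t -> t <= t' <= T ->
  controls T KG pi t u -> controls T KH pi t v ->
  controls T KG pi t' u' -> controls T KH pi t' v' ->
  {ae leb, forall r, t' <= r <= T -> u r om = u' r om /\ v r om = v' r om} ->
  enorm (traj T f t x u v om T - traj T f t' x' u' v' om T) <=
    2 * (enorm (x - x') + Cf * (t' - t)) * expR (2 * K * (T - t')).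
Proof.
move=> t0 /andP[tt' t'T] cu cv cu' cv' e.
have tT := le_trans tt' t'T; have t'0 := le_trans t0 tt'.
apply: (@solves_compare _ _ T K Cf lipschitz_gt0
  (controlled_field u v om) (controlled_field u' v' om)).
- by rewrite tt'.
- exact: (controlled_field_regular t0 om cu cv).
- exact: (controlled_field_regular t'0 om (controls_widen tt' cu) (controls_widen tt' cv)).
- exact: (controlled_field_regular t'0 om cu' cv').
- by apply: ae_mono e => r h rT y; rewrite /controlled_field; have [-> ->] := h rT.
- exact: (traj_solves t0 tT _ _ cu cv).
- exact: (traj_solves t'0 t'T _ _ cu' cv').
Qed.

Lemma traj_terminal pi t u v x om : 0 <= t <= T ->
  controls T KG pi t u -> controls T KH pi t v ->
  enorm (traj T f t x u v om T - x) <= Cf * (T - t).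
Proof.
move=> /andP[t0 tT] cu cv.
have [cX eX] := traj_solves t0 tT x om cu cv.
rewrite eX ?tT ?lexx// /picard_map addrC addKr.
apply: (vintegral_field_le (controlled_field_regular t0 om cu cv) _ _ tT) => //.
exact: continuous_measurable_path cX.
Qed.

Definition payoff t x u v (om : Om) : R := g (traj T f t x u v om T).

Lemma measurable_payoff pi t u v x : 0 <= t <= T ->
  controls T KG pi t u -> controls T KH pi t v ->
  measurable_fun setT (payoff t x u v).
Proof.
move=> /andP[t0 tT] cu cv.
(* The chosen trajectory coincides with the measurable one by uniqueness. *)
have [X [sX mX]] := controlled_solution t0 tT x cu cv.
have -> : payoff t x u v = g \o (fun om => X (T, om)).
  apply/funext => om; rewrite /payoff/=; congr g.
  apply/eqP; rewrite -subr_eq0; apply/eqP/enorm_eq0/eqP.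
  rewrite eq_le enorm_ge0 andbT.
  have := solves_stable tT lipschitz_gt0 (controlled_field_regular t0 om cu cv)
    (traj_solves t0 tT x om cu cv) (sX om) (s := T).
  by rewrite subrr enorm0 mulr0 mul0r tT lexx; apply.
apply: (measurable_comp_within measurableT (@dense_family_row R d) (A := setT)) => //.
- exact/continuous_subspaceT/(lipschitz_continuous g_lipschitz).
- by apply: ball_measurable_row => // k; exact: mX.
Qed.

(** * Values as nested bounds of expected payoffs *)

Section Game.
Variable pi : seq R.
Hypothesis hpi : itv_partition 0 T pi.

Section FixedStart.
Variables (t : R) (x : 'rV[R]_d).
Hypotheses (t0 : 0 <= t) (tT : t < T).
Local Notation A_ := (stratA T P pi t : set (process R V -> process R U)).
Local Notation B_ := (stratB T P pi t : set (process R U -> process R V)).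
Let i := time_index pi t.
Let Gi := @coord_events R [set k | (0 < k <= i)%N].
Implicit Types (alpha : process R V -> process R U) (beta : process R U -> process R V).

Lemma start_index_le : (i <= size pi)%N.
Proof. exact: ltnW (time_index_lt T0 hpi tT). Qed.

Lemma start_tpt_le : tpt pi i <= t.
Proof. exact: tpt_time_index. Qed.

Lemma start_in : 0 <= t <= T. Proof. by rewrite t0 ltW. Qed.

Definition game_payoff alpha beta (om : Om) : R :=
  g (traj_strat T P f pi t x alpha beta om T).

Lemma game_payoff_couple alpha beta : A_ alpha -> B_ beta ->
  exists u v, is_couple T P pi t alpha beta u v /\
    game_payoff alpha beta = payoff t x u v.
Proof.
move=> sa sb; have [v0 _] := V0.
have [u [v uv]] := couple_exists T0 hpi v0 start_index_le start_tpt_le sa sb.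
have := @xgetI _ (cst (cst 0)) [set X | exists u v,
  is_couple T P pi t alpha beta u v /\ X = traj T f t x u v] _
  (ex_intro _ u (ex_intro _ v (conj uv erefl))).
move=> [u' [v' [uv' e]]]; exists u', v'; split=> //.
by apply/funext => om; rewrite /game_payoff /traj_strat e.
Qed.

Lemma measurable_game_payoff alpha beta : A_ alpha -> B_ beta ->
  measurable_fun setT (game_payoff alpha beta).
Proof.
move=> sa sb; have [u [v [[cu cv _ _] ->]]] := game_payoff_couple sa sb.
exact: measurable_payoff start_in cu cv.
Qed.

Lemma integrable_game_payoff alpha beta : A_ alpha -> B_ beta ->
  P.-integrable setT (EFin \o game_payoff alpha beta).
Proof.
move=> sa sb; apply: (P_bounded_integrable (M := M)).
  exact: measurable_game_payoff.
by apply: aeW => w; exact: g_bounded.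
Qed.

(** For almost every [om] of [A] the two pairs of controls agree at almost all times,
    and the trajectory depends only on their classes in time. *)
Lemma couple_payoff_agree A alpha alpha' beta beta' u v u' v' : sigF i A ->
  A_ alpha' -> B_ beta' ->
  (forall v s om, A om -> alpha v s om = alpha' v s om) ->
  (forall u s om, A om -> beta u s om = beta' u s om) ->
  is_couple T P pi t alpha beta u v -> is_couple T P pi t alpha' beta' u' v' ->
  {ae P, forall om, A om -> payoff t x u v om = payoff t x u' v' om}.
Proof.
move=> iA sa' sb' aa' bb' uv uv'.
have := ae_sections (couples_agree hpi start_index_le start_tpt_le iA
  sa' sb' aa' bb' uv uv').
have [cu cv _ _] := uv; have [cu' cv' _ _] := uv'.
apply: ae_mono => om h Aom; rewrite /payoff; congr g.
apply/eqP; rewrite -subr_eq0; apply/eqP/enorm_eq0/eqP.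
rewrite eq_le enorm_ge0 andbT.
have tT' : t <= t <= T by rewrite lexx ltW.
apply: le_trans (traj_compare x x t0 tT' cu cv cu' cv' _) _.
  by apply: ae_mono h => r /= h rT; exact: h.
by rewrite !subrr enorm0 !(mulr0, mul0r, addr0).
Qed.

Lemma game_payoff_agree A alpha alpha' beta beta' : sigF i A ->
  A_ alpha -> A_ alpha' -> B_ beta -> B_ beta' ->
  (forall v s om, A om -> alpha v s om = alpha' v s om) ->
  (forall u s om, A om -> beta u s om = beta' u s om) ->
  {ae P, forall om, A om -> game_payoff alpha beta om = game_payoff alpha' beta' om}.
Proof.
move=> iA sa sa' sb sb' aa' bb'.
have [u [v [uv ->]]] := game_payoff_couple sa sb.
have [u' [v' [uv' ->]]] := game_payoff_couple sa' sb'.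
exact: couple_payoff_agree iA sa' sb' aa' bb' uv uv'.
Qed.

Lemma cond_payoffP alpha beta : A_ alpha -> B_ beta ->
  is_condexp P <<s Gi >> (game_payoff alpha beta)
    (cond_payoff T P f g pi t x alpha beta).
Proof.
by move=> sa sb; apply: condexpP; [exact: sigF_sub|exact: integrable_game_payoff].
Qed.

Lemma cond_payoff_agree A alpha alpha' beta beta' : sigF i A ->
  A_ alpha -> A_ alpha' -> B_ beta -> B_ beta' ->
  (forall v s om, A om -> alpha v s om = alpha' v s om) ->
  (forall u s om, A om -> beta u s om = beta' u s om) ->
  {ae P, forall om, A om -> cond_payoff T P f g pi t x alpha beta om =
    cond_payoff T P f g pi t x alpha' beta' om}.
Proof.
move=> iA sa sa' sb sb' aa' bb'.
apply: (condexp_eq_on (@sigF_sub R i) (cond_payoffP sa sb) (cond_payoffP sa' sb')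
  (integrable_game_payoff sa sb) (integrable_game_payoff sa' sb') iA).
exact: game_payoff_agree.
Qed.

Lemma K_measurable_cond_payoff alpha beta : A_ alpha -> B_ beta ->
  measurable_fun [set: g_sigma_algebraType Gi] (cond_payoff T P f g pi t x alpha beta).
Proof.
by move=> sa sb _ B mB; rewrite setTI; have [h _ _] := cond_payoffP sa sb; exact: h.
Qed.

Lemma cond_payoff_bounded alpha beta : A_ alpha -> B_ beta ->
  {ae P, forall om, `|cond_payoff T P f g pi t x alpha beta om| <= M}.
Proof.
move=> sa sb; have cp := cond_payoffP sa sb; have ip := integrable_game_payoff sa sb.
have ic (c : R) : P.-integrable [set: Om] (EFin \o cst c).
  exact: finite_measure_integrable_cst.
have KT : <<s Gi >> setT by exact: sigFT.
have gb om : - M <= game_payoff alpha beta om <= M.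
  by rewrite -ler_norml; exact: g_bounded.
have l1 : {ae P, forall om, [set: Om] om -> game_payoff alpha beta om <= cst M om}.
  by apply: aeW => om _; case/andP: (gb om).
have l2 : {ae P, forall om, [set: Om] om -> cst (- M) om <= game_payoff alpha beta om}.
  by apply: aeW => om _; case/andP: (gb om).
have h1 := condexp_le_on (@sigF_sub R i) cp (@is_condexp_cst R P Gi M) ip (ic M) KT l1.
have h2 := condexp_le_on (@sigF_sub R i) (@is_condexp_cst R P Gi (- M)) cp (ic (- M)) ip KT l2.
by apply: ae_mono2 h1 h2 => om {}h1 {}h2; rewrite ler_norml h1// h2.
Qed.

Definition expected_payoff alpha beta : R := \int[P]_om game_payoff alpha beta om.

Lemma expected_cond_payoff alpha beta : A_ alpha -> B_ beta ->
  \int[P]_om cond_payoff T P f g pi t x alpha beta om = expected_payoff alpha beta.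
Proof.
move=> sa sb; have [_ _ h] := cond_payoffP sa sb.
by rewrite /expected_payoff /Rintegral h//; exact: sigFT.
Qed.

Lemma stratA_nonempty : A_ !=set0.
Proof.
have [u0 _] := U0; exists (fun _ => const_process u0).
exact: NAD_const (@sigG0 R) (@sigGT R) _ _.
Qed.

Lemma stratB_nonempty : B_ !=set0.
Proof.
have [v0 _] := V0; exists (fun _ => const_process v0).
exact: NAD_const (@sigH0 R) (@sigHT R) _ _.
Qed.

Lemma stratA_paste A alpha1 alpha2 : A_ alpha1 -> A_ alpha2 -> sigF i A ->
  exists2 alpha, A_ alpha & forall beta, B_ beta -> {ae P, forall om,
    (A om -> cond_payoff T P f g pi t x alpha beta om =
      cond_payoff T P f g pi t x alpha1 beta om) /\
    (~ A om -> cond_payoff T P f g pi t x alpha beta om =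
      cond_payoff T P f g pi t x alpha2 beta om)}.
Proof.
move=> s1 s2 iA; have sp := NAD_paste hpi start_index_le start_tpt_le iA s1 s2.
exists (fun v => paste A (alpha1 v) (alpha2 v)) => // beta sb.
have pT v s om : A om -> paste A (alpha1 v) (alpha2 v) s om = alpha1 v s om.
  by move=> Aom; rewrite /paste asboolT.
have pF v s om : (~` A) om -> paste A (alpha1 v) (alpha2 v) s om = alpha2 v s om.
  by move=> Aom; rewrite /paste asboolF.
have h1 := cond_payoff_agree iA sp s1 sb sb pT (fun _ _ _ _ => erefl).
have h2 := cond_payoff_agree (sigFC iA) sp s2 sb sb pF (fun _ _ _ _ => erefl).
by apply: ae_mono2 h1 h2 => om e1 e2; split.
Qed.

Lemma stratB_paste A beta1 beta2 : B_ beta1 -> B_ beta2 -> sigF i A ->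
  exists2 beta, B_ beta & forall alpha, A_ alpha -> {ae P, forall om,
    (A om -> cond_payoff T P f g pi t x alpha beta om =
      cond_payoff T P f g pi t x alpha beta1 om) /\
    (~ A om -> cond_payoff T P f g pi t x alpha beta om =
      cond_payoff T P f g pi t x alpha beta2 om)}.
Proof.
move=> s1 s2 iA; have sp := NAD_paste hpi start_index_le start_tpt_le iA s1 s2.
exists (fun u => paste A (beta1 u) (beta2 u)) => // alpha sa.
have pT u s om : A om -> paste A (beta1 u) (beta2 u) s om = beta1 u s om.
  by move=> Aom; rewrite /paste asboolT.
have pF u s om : (~` A) om -> paste A (beta1 u) (beta2 u) s om = beta2 u s om.
  by move=> Aom; rewrite /paste asboolF.
have h1 := cond_payoff_agree iA sa sa sp s1 (fun _ _ _ _ => erefl) pT.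
have h2 := cond_payoff_agree (sigFC iA) sa sa sp s2 (fun _ _ _ _ => erefl) pF.
by apply: ae_mono2 h1 h2 => om e1 e2; split.
Qed.

Lemma payoff_bound_ge0 : 0 <= M.
Proof. exact: le_trans (normr_ge0 _) (g_bounded 0). Qed.

Lemma expected_payoff_bounded alpha beta : A_ alpha -> B_ beta ->
  `|expected_payoff alpha beta| <= M.
Proof.
move=> sa sb; have ip := integrable_game_payoff sa sb.
apply: le_trans (le_normr_Rintegral measurableT ip) _.
rewrite -[leRHS]mulr1.
have -> : 1 = fine (P [set: Om]) by rewrite probability_setT.
rewrite -(Rintegral_cst P measurableT); apply: le_Rintegral => //.
- exact: integrable_norm ip.
- exact: finite_measure_integrable_cst.
- by move=> om _; exact: g_bounded.
Qed.

(** Conditional payoffs depend on the strategies event by event of the initial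
    sigma-field, along which strategies can be pasted; so the essential bounds
    commute with the expectation, and conditioning disappears. *)
Lemma lower_valueE : lower_value T P f g pi t x =
  sup [set inf [set expected_payoff alpha beta | beta in B_] | alpha in A_].
Proof.
rewrite /lower_value lt_eqF// unlock.
have := expectation_esssup_essinf (@sigF_sub R i) payoff_bound_ge0
  stratA_nonempty stratB_nonempty K_measurable_cond_payoff cond_payoff_bounded
  (fun a1 a2 A => @stratA_paste A a1 a2) (fun b1 b2 A => @stratB_paste A b1 b2).
rewrite /Rintegral => ->; congr sup; apply: eq_imagel => alpha sa.
by congr inf; apply: eq_imagel => beta sb; exact: expected_cond_payoff.
Qed.

Lemma upper_valueE : upper_value T P f g pi t x =
  inf [set sup [set expected_payoff alpha beta | alpha in A_] | beta in B_].
Proof.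
rewrite /upper_value lt_eqF// unlock.
have := expectation_essinf_esssup (@sigF_sub R i) payoff_bound_ge0
  stratA_nonempty stratB_nonempty K_measurable_cond_payoff cond_payoff_bounded
  (fun a1 a2 A => @stratA_paste A a1 a2) (fun b1 b2 A => @stratB_paste A b1 b2).
rewrite /Rintegral => ->; congr inf; apply: eq_imagel => beta sb.
by congr sup; apply: eq_imagel => alpha sa; exact: expected_cond_payoff.
Qed.

End FixedStart.

(** * Comparison of two starting points *)

(** Used with [w] a player's control in a couple and [w'] the control computed by
    the strategy that was extended by a constant before [t']. Since [w] is then
    constant before [t'], replacing it there by the same constant changes nothing,
    and the opponent's strategy [sigma] does not notice. *)
Lemma switch_restart (E E' : metricType R) (KE KE' : nat -> set (set Om)) t t' e
    (sigma : process R E -> process R E') (w w' : process R E) :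
  (forall j, KE j set0) -> (forall j, KE j setT) -> t <= t' ->
  NAD T P KE KE' pi t sigma -> controls T KE pi t w ->
  ae_eq_upto P t (cst T) (switch t' (const_process e) w') w ->
  ae_eq_upto P t' (cst T) w' w /\
  ae_eq_upto P t' (cst T) (sigma (switch t' (const_process e) w)) (sigma w).
Proof.
move=> KE0 KET tt' sN cw ww'.
have sw : ae_eq_upto P t' (cst T) w' w.
  apply: ae_mono ww' => z h /andP[t'z zT].
  have := h; rewrite /switch ltNge t'z /= (le_trans tt' t'z) zT.
  exact.
split=> //; apply: (ae_eq_upto_le tt' (fun om => lexx _)).
have n0 : (0 < size pi <= size pi)%N by rewrite (size_partition_gt0 T0 hpi) leqnn.
rewrite -(tpt_size hpi); apply: (NAD_upto_same hpi sN n0) => //.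
  by apply: controls_switch => //; exact: controls_widen cw.
rewrite (tpt_size hpi); apply: ae_mono ww' => z h tz; rewrite -[RHS]h//.
rewrite /switch; case: ltP => // t'z.
by rewrite -h// /switch ltNge t'z.
Qed.

Section TwoStarts.
Variables (t t' : R) (x x' : 'rV[R]_d).
Hypotheses (t0 : 0 <= t) (tt' : t <= t').

Definition value_lipschitz : R :=
  `|Lg| * (2 * (1 + Cf) * expR (2 * K * T)).

Lemma field_bound : 0 <= Cf.
Proof.
have [u0 _] := U0; have [v0 _] := V0.
apply: le_trans (enorm_ge0 _) (f_bounded 0 u0 v0 (t := 0) _).
by rewrite lexx ltW.
Qed.

Let dist := `|t - t'| + enorm (x - x').

Lemma payoff_compare u v om : t' <= T ->
  controls T KG pi t u -> controls T KH pi t v ->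
  `|payoff t x u v om - payoff t' x' u v om| <= value_lipschitz * dist.
Proof.
move=> t'T cu cv; apply: le_trans (g_lipschitz _ _) _.
apply: le_trans (ler_wpM2r (enorm_ge0 _) (ler_norm Lg)) _.
rewrite /value_lipschitz -[leRHS]mulrA ler_wpM2l//.
have tT' : t <= t' <= T by rewrite tt'.
apply: le_trans (traj_compare x x' t0 tT' cu cv (controls_widen tt' cu)
  (controls_widen tt' cv) _) _; first exact: aeW.
have hE : expR (2 * K * (T - t')) <= expR (2 * K * T).
  rewrite ler_expR ler_wpM2l ?mulr_ge0 ?(ltW lipschitz_gt0)//.
  by rewrite gerBl (le_trans t0).
have d0 : 0 <= t' - t by rewrite subr_ge0.
have hD : enorm (x - x') + Cf * (t' - t) <= (1 + Cf) * dist.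
  have c0 := field_bound; have e0 := enorm_ge0 (x - x').
  rewrite /dist distrC (ger0_norm d0) mulrDl mul1r lerD//.
    by rewrite lerDr.
  by rewrite ler_wpM2l// lerDl.
apply: (@le_trans _ _ (2 * ((1 + Cf) * dist) * expR (2 * K * T))).
  rewrite ler_pM ?expR_ge0//; last by rewrite ler_wpM2l.
  by rewrite mulr_ge0// addr_ge0 ?enorm_ge0// mulr_ge0// field_bound.
by rewrite le_eqVlt; apply/orP; left; apply/eqP; ring.
Qed.

(** Both expectations are taken along the same pair of controls. *)
Lemma expected_compare alpha beta alpha' beta' u v : t' < T ->
  stratA T P pi t alpha -> stratB T P pi t beta ->
  stratA T P pi t' alpha' -> stratB T P pi t' beta' ->
  is_couple T P pi t alpha beta u v -> is_couple T P pi t' alpha' beta' u v ->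
  `|expected_payoff t x alpha beta - expected_payoff t' x' alpha' beta'| <=
    value_lipschitz * dist.
Proof.
move=> t'T sa sb sa' sb' uv uv'.
have tT := le_lt_trans tt' t'T; have t'0 := le_trans t0 tt'.
have toE r y (a : process R V -> process R U) b : 0 <= r -> r < T ->
    stratA T P pi r a -> stratB T P pi r b -> is_couple T P pi r a b u v ->
    expected_payoff r y a b = \int[P]_om payoff r y u v om.
  move=> r0 rT ra rb ruv; have [u1 [v1 [uv1 e]]] := game_payoff_couple y r0 rT ra rb.
  rewrite /expected_payoff e; have [cu cv _ _] := ruv; have [cu1 cv1 _ _] := uv1.
  have rr : 0 <= r <= T by rewrite r0 ltW.
  have agree := couple_payoff_agree y r0 rT (@sigFT R _) ra rb (fun _ _ _ _ => erefl)
    (fun _ _ _ _ => erefl) uv1 ruv.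
  exact: (ae_eq_Rintegral measurableT (measurable_payoff y rr cu1 cv1)
    (measurable_payoff y rr cu cv) agree).
rewrite (toE t x alpha beta)// (toE t' x' alpha' beta')//.
have [cu cv _ _] := uv; have [cu' cv' _ _] := uv'.
have iP r y : 0 <= r -> r < T -> controls T KG pi r u -> controls T KH pi r v ->
    P.-integrable setT (EFin \o payoff r y u v).
  move=> r0 rT ru rv; apply: (P_bounded_integrable (M := M)).
    by apply: measurable_payoff ru rv; rewrite r0 ltW.
  by apply: aeW => om; exact: g_bounded.
have i1 := iP t x t0 tT cu cv; have i2 := iP t' x' t'0 t'T cu' cv'.
have i12 : P.-integrable setT
    (EFin \o (fun om => payoff t x u v om - payoff t' x' u v om)).
  exact: (integrableB measurableT i1 i2).
rewrite -RintegralB//; apply: le_trans (le_normr_Rintegral measurableT i12) _.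
rewrite -[leRHS]mulr1.
have -> : 1 = fine (P [set: Om]) by rewrite probability_setT.
rewrite -(Rintegral_cst P measurableT); apply: le_Rintegral => //.
- exact: integrable_norm i12.
- exact: finite_measure_integrable_cst.
- by move=> om _; exact: payoff_compare (ltW t'T) cu cv.
Qed.

Section Matching.
Hypothesis t'T : t' < T.
Let tT : t < T := le_lt_trans tt' t'T.
Let t'0 : 0 <= t' := le_trans t0 tt'.
Variables (u0 : U) (v0 : V).

(** Take a couple of the game started at [t]: restricted to [t', T] it is a couple
    of the other game. *)
Lemma expected_extendB alpha beta :
  stratA T P pi t alpha -> stratB T P pi t' beta ->
  `|expected_payoff t x alpha (fun u => switch t' (const_process v0) (beta u)) -
    expected_payoff t' x' (fun v => alpha (switch t' (const_process v0) v)) beta|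
  <= value_lipschitz * dist.
Proof.
move=> sa sb.
have sb' := NAD_extend (@sigH0 R) (@sigHT R) v0 tt' sb.
have sa' := NAD_restrict (@sigH0 R) (@sigHT R) v0 tt' sa.
have [u [v uv]] := couple_exists T0 hpi v0 (start_index_le tT) (start_tpt_le t0) sa sb'.
apply: (expected_compare t'T sa sb' sa' sb uv).
have [cu cv au bv] := uv.
have [bv' av'] := switch_restart (@sigH0 R) (@sigHT R) tt' sa cv bv.
split=> //; [exact: (controls_widen tt')|exact: (controls_widen tt')|].
exact: ae_eq_upto_trans av' (ae_eq_upto_le tt' (fun om => lexx _) au).
Qed.

(** As [expected_extendB], with the roles of the players exchanged. *)
Lemma expected_extendA alpha beta :
  stratA T P pi t' alpha -> stratB T P pi t beta ->
  `|expected_payoff t x (fun v => switch t' (const_process u0) (alpha v)) beta -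
    expected_payoff t' x' alpha (fun u => beta (switch t' (const_process u0) u))|
  <= value_lipschitz * dist.
Proof.
move=> sa sb.
have sa' := NAD_extend (@sigG0 R) (@sigGT R) u0 tt' sa.
have sb' := NAD_restrict (@sigG0 R) (@sigGT R) u0 tt' sb.
have [u [v uv]] := couple_exists T0 hpi v0 (start_index_le tT) (start_tpt_le t0) sa' sb.
apply: (expected_compare t'T sa' sb sa sb' uv).
have [cu cv au bv] := uv.
have [au' bv'] := switch_restart (@sigG0 R) (@sigGT R) tt' sb cu au.
split=> //; [exact: (controls_widen tt')|exact: (controls_widen tt')|].
exact: ae_eq_upto_trans bv' (ae_eq_upto_le tt' (fun om => lexx _) bv).
Qed.

Lemma lower_value_compare :
  `|lower_value T P f g pi t x - lower_value T P f g pi t' x'| <= value_lipschitz * dist.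
Proof.
rewrite (lower_valueE x t0 tT) (lower_valueE x' t'0 t'T) ler_distlC.
rewrite lerBlDr; apply/andP; split.
  apply: (sup_inf_le (stratA_nonempty t) (stratB_nonempty t')
    (expected_payoff_bounded x t0 tT) (expected_payoff_bounded x' t'0 t'T)) => alpha sa.
  exists (fun v => alpha (switch t' (const_process v0) v)).
    exact: (NAD_restrict (@sigH0 R) (@sigHT R) v0 tt' sa).
  move=> beta sb; exists (fun u => switch t' (const_process v0) (beta u)).
    exact: (NAD_extend (@sigH0 R) (@sigHT R) v0 tt' sb).
  by have := expected_extendB sa sb; rewrite ler_norml => /andP[_]; rewrite lerBlDl.
apply: (sup_inf_le (stratA_nonempty t') (stratB_nonempty t) (expected_payoff_bounded x' t'0 t'T)
    (expected_payoff_bounded x t0 tT)) => alpha sa.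
exists (fun v => switch t' (const_process u0) (alpha v)).
  exact: (NAD_extend (@sigG0 R) (@sigGT R) u0 tt' sa).
move=> beta sb; exists (fun u => beta (switch t' (const_process u0) u)).
  exact: (NAD_restrict (@sigG0 R) (@sigGT R) u0 tt' sb).
have := expected_extendA sa sb; rewrite ler_norml => /andP[+ _].
by rewrite lerNl opprB lerBlDl.
Qed.

Lemma upper_value_compare :
  `|upper_value T P f g pi t x - upper_value T P f g pi t' x'| <= value_lipschitz * dist.
Proof.
rewrite (upper_valueE x t0 tT) (upper_valueE x' t'0 t'T) ler_distlC.
rewrite lerBlDr; apply/andP; split.
  apply: (inf_sup_le (stratA_nonempty t) (stratB_nonempty t')
    (expected_payoff_bounded x t0 tT) (expected_payoff_bounded x' t'0 t'T)) => beta sb.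
  exists (fun u => switch t' (const_process v0) (beta u)).
    exact: (NAD_extend (@sigH0 R) (@sigHT R) v0 tt' sb).
  move=> alpha sa; exists (fun v => alpha (switch t' (const_process v0) v)).
    exact: (NAD_restrict (@sigH0 R) (@sigHT R) v0 tt' sa).
  by have := expected_extendB sa sb; rewrite ler_norml => /andP[_]; rewrite lerBlDl.
apply: (inf_sup_le (stratA_nonempty t') (stratB_nonempty t) (expected_payoff_bounded x' t'0 t'T)
    (expected_payoff_bounded x t0 tT)) => beta sb.
exists (fun u => beta (switch t' (const_process u0) u)).
  exact: (NAD_restrict (@sigG0 R) (@sigGT R) u0 tt' sb).
move=> alpha sa; exists (fun v => switch t' (const_process u0) (alpha v)).
  exact: (NAD_extend (@sigG0 R) (@sigGT R) u0 tt' sa).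
have := expected_extendA sa sb; rewrite ler_norml => /andP[+ _].
by rewrite lerNl opprB lerBlDl.
Qed.

End Matching.

(** At the horizon the value is the terminal payoff, which the trajectory cannot
    leave by more than the elapsed time allows. *)
Lemma expected_terminal alpha beta : t' = T -> t < T ->
  stratA T P pi t alpha -> stratB T P pi t beta ->
  `|expected_payoff t x alpha beta - g x'| <= value_lipschitz * dist.
Proof.
move=> t'E tT sa sb.
have [u [v [[cu cv _ _] e]]] := game_payoff_couple x t0 tT sa sb.
have ip := integrable_game_payoff x t0 tT sa sb.
have ic : P.-integrable [set: Om] (EFin \o cst (g x')).
  exact: finite_measure_integrable_cst.
have c1 : 1 = fine (P [set: Om]) by rewrite probability_setT.
have -> : g x' = \int[P]_(_ in [set: Om]) g x'.
  by rewrite (Rintegral_cst P measurableT) -c1 mulr1.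
rewrite /expected_payoff -RintegralB//.
have i12 : P.-integrable setT (EFin \o (fun om => game_payoff t x alpha beta om - g x')).
  exact: (integrableB measurableT ip ic).
apply: le_trans (le_normr_Rintegral measurableT i12) _.
rewrite -[leRHS]mulr1 c1 -(Rintegral_cst P measurableT); apply: le_Rintegral => //.
- exact: integrable_norm i12.
- exact: finite_measure_integrable_cst.
move=> om _; rewrite e /payoff; apply: le_trans (g_lipschitz _ _) _.
apply: le_trans (ler_wpM2r (enorm_ge0 _) (ler_norm Lg)) _.
rewrite /value_lipschitz -[leRHS]mulrA ler_wpM2l//.
have tT' : 0 <= t <= T by rewrite t0 ltW.
apply: le_trans (ler_enorm_distD _ x _) _.
have h := traj_terminal x om tT' cu cv.
have E1 : 1 <= expR (2 * K * T).
  by rewrite -expR0 ler_expR mulr_ge0 ?(ltW T0)// mulr_ge0// ltW// lipschitz_gt0.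
have c0 := field_bound; have e0 := enorm_ge0 (x - x').
have d0 : 0 <= T - t by rewrite subr_ge0 ltW.
have dd : dist = (T - t) + enorm (x - x').
  by rewrite /dist t'E distrC ger0_norm.
have dist0 : 0 <= dist by rewrite dd addr_ge0.
apply: (@le_trans _ _ ((1 + Cf) * dist)); first by rewrite dd; nra.
rewrite ler_wpM2r// -[leLHS]mulr1 ler_pM//; first by rewrite addr_ge0.
by rewrite ler_peMl ?addr_ge0// ler1n.
Qed.

(** A number as the value of a game in which each player has a single strategy: the
    game at the horizon. *)
Lemma sup_inf_cst (y : R) :
  sup [set inf [set y | _ in [set: unit]] | _ in [set: unit]] = y.
Proof.
have E (z : R) : [set z | _ in [set: unit]] = [set z].
  by apply/seteqP; split=> [_ [_ _ <-]//|_ ->]; exists tt.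
by rewrite !E inf1 sup1.
Qed.

Lemma inf_sup_cst (y : R) :
  inf [set sup [set y | _ in [set: unit]] | _ in [set: unit]] = y.
Proof.
have E (z : R) : [set z | _ in [set: unit]] = [set z].
  by apply/seteqP; split=> [_ [_ _ <-]//|_ ->]; exists tt.
by rewrite !E sup1 inf1.
Qed.

Lemma lower_value_terminal : t' = T -> t < T ->
  `|lower_value T P f g pi t x - g x'| <= value_lipschitz * dist.
Proof.
move=> t'E tT; rewrite (lower_valueE x t0 tT) -[X in _ - X]sup_inf_cst ler_distlC.
have ut0 : [set: unit] !=set0 by exists tt.
have gM (i j : unit) : [set: unit] i -> [set: unit] j -> `|g x'| <= M by [].
rewrite lerBlDr; apply/andP; split.
  apply: (sup_inf_le (stratA_nonempty t) ut0 (expected_payoff_bounded x t0 tT) gM) => alpha sa.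
  exists tt => // _ _; have [beta sb] := stratB_nonempty t; exists beta => //.
  by have := expected_terminal t'E tT sa sb; rewrite ler_norml => /andP[_]; rewrite lerBlDl.
apply: (sup_inf_le ut0 (stratB_nonempty t) gM (expected_payoff_bounded x t0 tT)) => _ _.
have [alpha sa] := stratA_nonempty t; exists alpha => // beta sb; exists tt => //.
have := expected_terminal t'E tT sa sb; rewrite ler_norml => /andP[+ _].
by rewrite lerNl opprB lerBlDl.
Qed.

Lemma upper_value_terminal : t' = T -> t < T ->
  `|upper_value T P f g pi t x - g x'| <= value_lipschitz * dist.
Proof.
move=> t'E tT; rewrite (upper_valueE x t0 tT) -[X in _ - X]inf_sup_cst ler_distlC.
have ut0 : [set: unit] !=set0 by exists tt.
have gM (i j : unit) : [set: unit] i -> [set: unit] j -> `|g x'| <= M by [].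
rewrite lerBlDr; apply/andP; split.
  apply: (inf_sup_le (stratA_nonempty t) ut0 (expected_payoff_bounded x t0 tT) gM) => _ _.
  have [beta sb] := stratB_nonempty t; exists beta => // alpha sa; exists tt => //.
  by have := expected_terminal t'E tT sa sb; rewrite ler_norml => /andP[_]; rewrite lerBlDl.
apply: (inf_sup_le ut0 (stratB_nonempty t) gM (expected_payoff_bounded x t0 tT)) => beta sb.
exists tt => // _ _; have [alpha sa] := stratA_nonempty t; exists alpha => //.
have := expected_terminal t'E tT sa sb; rewrite ler_norml => /andP[+ _].
by rewrite lerNl opprB lerBlDl.
Qed.

Lemma values_compare : t' <= T ->
  `|lower_value T P f g pi t x - lower_value T P f g pi t' x'| +
  `|upper_value T P f g pi t x - upper_value T P f g pi t' x'| <=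
    2 * value_lipschitz * dist.
Proof.
have [u0 _] := U0; have [v0 _] := V0.
rewrite -mulrA mulr_natl mulr2n le_eqVlt => /predU1P[t'E|t'T].
  have lT : lower_value T P f g pi t' x' = g x' by rewrite /lower_value t'E eqxx.
  have uT : upper_value T P f g pi t' x' = g x' by rewrite /upper_value t'E eqxx.
  rewrite lT uT; have [tT|Tt] := ltP t T.
    by rewrite lerD ?lower_value_terminal ?upper_value_terminal.
  have tE : t = T by apply/le_anti; rewrite Tt andbT -t'E.
  rewrite /lower_value /upper_value tE eqxx.
  have gl : `|g x - g x'| <= value_lipschitz * dist.
    apply: le_trans (g_lipschitz _ _) _.
    apply: le_trans (ler_wpM2r (enorm_ge0 _) (ler_norm Lg)) _.
    rewrite /value_lipschitz -[leRHS]mulrA ler_wpM2l//.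
    have E1 : 1 <= expR (2 * K * T).
      by rewrite -expR0 ler_expR mulr_ge0 ?(ltW T0)// mulr_ge0// ltW// lipschitz_gt0.
    have c0 := field_bound; have e0 := enorm_ge0 (x - x').
    have -> : dist = enorm (x - x') by rewrite /dist tE t'E subrr normr0 add0r.
    by rewrite ler_peMl//; nra.
  by rewrite lerD.
by rewrite lerD ?(lower_value_compare t'T u0 v0) ?(upper_value_compare t'T u0 v0).
Qed.

End TwoStarts.

End Game.

End Payoffs.

Theorem lemma3p5 (R : realType) (T Cf Lf Lg : R) (hT : 0 < T) :
  exists L : R,
  forall (d : nat) (U V : metricType R)
    (f : R -> 'rV[R]_d -> U -> V -> 'rV[R]_d) (g : 'rV[R]_d -> R)
    (P : probability (Omega R) R),
  compact [set: U] -> [set: U] !=set0 ->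
  compact [set: V] -> [set: V] !=set0 ->
  {within [set z : R * 'rV[R]_d * U * V | 0 <= z.1.1.1 <= T],
    continuous (fun z : R * 'rV[R]_d * U * V => f z.1.1.1 z.1.1.2 z.1.2 z.2)} ->
  (forall t x u v, 0 <= t <= T -> enorm (f t x u v) <= Cf) ->
  (forall t x x' u v, 0 <= t <= T ->
    enorm (f t x u v - f t x' u v) <= Lf * enorm (x - x')) ->
  (exists M : R, forall x, `|g x| <= M) ->
  (forall x x', `|g x - g x'| <= Lg * enorm (x - x')) ->
  is_lebesgue_power P ->
  forall pi : seq R, itv_partition 0 T pi ->
  forall (t t' : R) (x x' : 'rV[R]_d), 0 <= t <= T -> 0 <= t' <= T ->
    `|lower_value T P f g pi t x - lower_value T P f g pi t' x'| +
    `|upper_value T P f g pi t x - upper_value T P f g pi t' x'|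
      <= L * (`|t - t'| + enorm (x - x')).
Proof.
exists (2 * value_lipschitz T Cf Lf Lg).
move=> d U V f g P cU U0 cV V0 fc fb fl [M gM] gl _ pi hpi t t' x x'.
move=> /andP[t0 tT] /andP[t'0 t'T].
have [tt'|/ltW t't] := leP t t'.
  exact: (values_compare hT P cU U0 cV V0 fc fb fl gM gl hpi x x' t0 tt' t'T).
rewrite distrC [X in _ + X <= _]distrC (distrC t) (enormB x).
exact: (values_compare hT P cU U0 cV V0 fc fb fl gM gl hpi x' x t'0 t't tT).
Qed.
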